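(* Let $\sigma>0$ and $m>0$ be fixed and let $\varepsilon=0$ or $\varepsilon=1$. If $(w^{\varepsilon},s^{\varepsilon})$ is a solution to problem $(P_1^* )$ for this $\varepsilon$, then a parametric explicit solution $(\theta^\varepsilon,Y_0^\varepsilon,Y_1^\varepsilon)$ to problem $(P_4^* )$ is given by $$\theta^{\varepsilon}(y,t)=\frac{m\,w_z^{\varepsilon}(z,t)w^{\varepsilon}(z,t)-\frac{\sigma}{2}[w^{\varepsilon}(z,t)]^2}{w_{zz}^{\varepsilon}(z,t)w^{\varepsilon}(z,t)-[w_z^{\varepsilon}(z,t)]^2},\qquad Y_0^{\varepsilon}(t)\le y\le Y_1^{\varepsilon}(t),\ t>0,$$ $$y=\frac1m\ln\left(1-\frac{2m\,w_z^{\varepsilon}(z,t)}{\sigma\,w^{\varepsilon}(z,t)}\right),\qquad 0\le z\le s^{\varepsilon}(t),\ t>0,$$ where $z$ is the parameter and the free boundaries are $$Y_0^{\varepsilon}(t)=\frac1m\ln\left(1-\frac{2m\,w_z^{\varepsilon}(0,t)}{\sigma\,w^{\varepsilon}(0,t)}\right),\qquad Y_1^{\varepsilon}(t)=\frac1m\ln\left(1-\frac{2m\,w_z^{\varepsilon}(s^{\varepsilon}(t),t)}{\sigma\,w^{\varepsilon}(s^{\varepsilon}(t),t)}\right),\qquad t>0.$$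
   Context: Data: $L=L(t)$ and $v=v(t)$ are continuous and positive for $t>0$; $w_m=w_m(t)$ is differentiable, $v(t)>w_m(t)>0$ for $t>0$, and $v(0)=w_m(0)$; $h=h(t)$ is continuous and positive for $t>0$. Problem $(P_1^* )$, with unknowns $(w,s)$: $w_{zz}=w_t$ for $0<z<s(t)$, $t>0$; $w_z(s(t),t)=-L(t)s'(t)$, $t>0$; $w(s(t),t)=w_m(t)$, $t>0$; $w_z(0,t)=h(t)(\varepsilon w(0,t)-v(t))$, $t>0$; $s(0)=0$. A pair $(w,s)$ is a solution if $w,w_z,w_t,w_{zz}$ are continuous in $\{(z,t):0<z<s(t),\ t>0\}$ and all these conditions are satisfied. The paper takes from the literature (Friedman, 1959) that such $w$ satisfies $w>0$ and $w_z\le 0$ up to the boundaries $z=0$ and $z=s(t)$, so that the quotients and logarithms make sense. Problem $(P_4^* )$, with unknowns $(\theta,Y_0,Y_1)$: $\theta_t=-(\theta^{-1})_{yy}-m(\theta^{-1})_y+\sigma\exp(my)$ for $Y_0(t)<y<Y_1(t)$, $t>0$; $Y_1(t)=\frac{\ln(1+mI_1(t))}{m}$, $t>0$; $\theta(Y_1(t),t)=\exp(mY_1(t))\left(-\frac{2}{\sigma}\frac{w_m'(t)}{w_m(t)}+\frac{\sigma(\exp(mY_1(t))-1)^2}{2m^2}\left(1-\frac{w_m(t)}{L(t)}\right)\right)^{-1}$, $t>0$; $h(t)v(t)=\left[h(t)\varepsilon+\frac{\sigma(\exp(mY_0(t))-1)}{2m}\right]w_m(0)\exp\left(\int_0^t\left(\frac{\sigma^2(\exp(mY_0(\tau))-1)^2}{4m^2}-\frac{\sigma\exp(mY_0(\tau))}{2\theta(Y_0(\tau),\tau)}\right)d\tau\right)$,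 $t>0$; $Y_0(t)=\frac{\ln(1+mI_0(t))}{m}$, $t>0$; where $I_0(t)=-\int_0^t\exp(mY_0(\tau))\left(\frac{\sigma(\exp(mY_0(\tau))-1)}{m\theta(Y_0(\tau),\tau)}+\frac{\theta_y(Y_0(\tau),\tau)-m\theta(Y_0(\tau),\tau)}{\theta^3(Y_0(\tau),\tau)}\right)d\tau$, $I_1(t)=\int_0^t\exp(mY_1(\tau))\left(\frac{\sigma(\exp(mY_1(\tau))-1)}{m\theta(Y_1(\tau),\tau)}\left(\frac{w_m(\tau)}{2L(\tau)}-1\right)-\frac{\theta_y(Y_1(\tau),\tau)-m\theta(Y_1(\tau),\tau)}{\theta^3(Y_1(\tau),\tau)}\right)d\tau$.
   Formalization: Added, as the claim fails otherwise: w_zz and w_zzz extend continuously to z=0 and z=s(t); w_m(0)>0, w(0,t)→w_m(0), w_z(0,t)→0 and w_z(s(t),t)→0 as t→0+; w_zz·w−w_z²≠0 and Y_0<Y_1 for t>0. Integrals from 0 may be improper at 0. *)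

(* Defs.v *)
From Stdlib Require Import Reals.
From Coquelicot Require Import Coquelicot.
Open Scope R_scope.

(* Convention for functions [f : R -> R -> R] of (space, time) on a moving
   domain: a function named as a partial derivative is that derivative in the
   open domain, and its boundary values are its continuous extension
   ([continuous_on] the closed domain).  The time t = 0 belongs to neither
   domain. *)

Definition open_dom (a b : R -> R) (p : R * R) : Prop :=
  0 < snd p /\ a (snd p) < fst p < b (snd p).

Definition closed_dom (a b : R -> R) (p : R * R) : Prop :=
  0 < snd p /\ a (snd p) <= fst p <= b (snd p).

Definition cont2_on (D : R * R -> Prop) (f : R -> R -> R) : Prop :=
  continuous_on D (fun p : R * R => f (fst p) (snd p)).

Definition zero_bd (t : R) : R := 0.

(* Integral over ]0, t], improper at 0. *)
Definition is_int_from_0 (f : R -> R) (t l : R) : Prop :=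
  is_RInt_gen f (at_right 0) (at_point t) l.

Record P1_data (L v wm h : R -> R) : Prop := {
  P1_L : forall t, 0 < t -> continuous L t /\ 0 < L t;
  P1_v : forall t, 0 < t -> continuous v t /\ 0 < v t;
  P1_wm : forall t, 0 < t -> ex_derive wm t;
  P1_wm0 : filterlim wm (at_right 0) (locally (wm 0));
  P1_v_wm : forall t, 0 < t -> 0 < wm t < v t;
  P1_v0 : v 0 = wm 0;
  P1_h : forall t, 0 < t -> continuous h t /\ 0 < h t
}.

Record P1_solution (eps : R) (L v wm h : R -> R)
    (w wz wt wzz : R -> R -> R) (s : R -> R) : Prop := {
  P1_s_pos : forall t, 0 < t -> 0 < s t;
  P1_s0 : s 0 = 0;
  P1_s_init : filterlim s (at_right 0) (locally (s 0));
  P1_wz : forall z t, open_dom zero_bd s (z, t) ->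
    is_derive (fun x => w x t) z (wz z t);
  P1_wzz : forall z t, open_dom zero_bd s (z, t) ->
    is_derive (fun x => wz x t) z (wzz z t);
  P1_wt : forall z t, open_dom zero_bd s (z, t) ->
    is_derive (fun tau => w z tau) t (wt z t);
  P1_wt_cont : cont2_on (open_dom zero_bd s) wt;
  P1_wzz_cont : cont2_on (open_dom zero_bd s) wzz;
  P1_w_cont : cont2_on (closed_dom zero_bd s) w;
  P1_wz_cont : cont2_on (closed_dom zero_bd s) wz;
  P1_heat : forall z t, open_dom zero_bd s (z, t) -> wzz z t = wt z t;
  P1_stefan : forall t, 0 < t ->
    ex_derive s t /\ wz (s t) t = - L t * Derive s t;
  P1_free : forall t, 0 < t -> w (s t) t = wm t;
  P1_fixed : forall t, 0 < t -> wz 0 t = h t * (eps * w 0 t - v t)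
}.

Definition sign_conditions (w wz : R -> R -> R) (s : R -> R) : Prop :=
  forall z t, closed_dom zero_bd s (z, t) -> 0 < w z t /\ wz z t <= 0.

(* Regularity at the lateral boundaries, t > 0: it gives a meaning to w_zz and
   to theta_y (a third derivative of w) at z = 0 and z = s(t). *)
Definition regular_to_boundary (wzz : R -> R -> R) (s : R -> R) : Prop :=
  cont2_on (closed_dom zero_bd s) wzz /\
  exists wzzz : R -> R -> R,
    (forall z t, open_dom zero_bd s (z, t) ->
       is_derive (fun x => wzz x t) z (wzzz z t)) /\
    cont2_on (closed_dom zero_bd s) wzzz.

(* Compatibility at the corner z = t = 0.  The equations [P4_Y0] and [P4_Y1]
   contain integrals from 0 to t and so force Y0(0+) = Y1(0+) = 0, which means
   w_z -> 0 along both boundaries; the equation [P4_robin] forces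
   w(0,0+) = w_m(0) > 0. *)
Definition corner_compatible (wm : R -> R) (w wz : R -> R -> R) (s : R -> R)
    : Prop :=
  0 < wm 0 /\
  filterlim (fun t => w 0 t) (at_right 0) (locally (wm 0)) /\
  filterlim (fun t => wz 0 t) (at_right 0) (locally 0) /\
  filterlim (fun t => wz (s t) t) (at_right 0) (locally 0).

Definition y_par (sigma m : R) (w wz : R -> R -> R) (z t : R) : R :=
  1 / m * ln (1 - 2 * m * wz z t / (sigma * w z t)).

Definition theta_den (w wz wzz : R -> R -> R) (z t : R) : R :=
  wzz z t * w z t - (wz z t) ^ 2.

Definition theta_par (sigma m : R) (w wz wzz : R -> R -> R) (z t : R) : R :=
  (m * wz z t * w z t - sigma / 2 * (w z t) ^ 2) / theta_den w wz wzz z t.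

Definition Y0_of (sigma m : R) (w wz : R -> R -> R) (t : R) : R :=
  y_par sigma m w wz 0 t.

Definition Y1_of (sigma m : R) (w wz : R -> R -> R) (s : R -> R) (t : R) : R :=
  y_par sigma m w wz (s t) t.

(* The parametric formulas make sense: the quotient is defined and the range
   of y is a nondegenerate interval. *)
Definition nondegenerate (sigma m : R) (w wz wzz : R -> R -> R) (s : R -> R)
    : Prop :=
  (forall z t, closed_dom zero_bd s (z, t) -> theta_den w wz wzz z t <> 0) /\
  (forall t, 0 < t -> Y0_of sigma m w wz t < Y1_of sigma m w wz s t).

Definition parametric_form (sigma m : R) (w wz wzz : R -> R -> R)
    (s : R -> R) (theta : R -> R -> R) (Y0 Y1 : R -> R) : Prop :=
  (forall y t, closed_dom Y0 Y1 (y, t) ->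
     exists! z, 0 <= z <= s t /\ y = y_par sigma m w wz z t) /\
  (forall z t, closed_dom zero_bd s (z, t) ->
     Y0 t <= y_par sigma m w wz z t <= Y1 t /\
     theta (y_par sigma m w wz z t) t = theta_par sigma m w wz wzz z t).

Definition I0_integrand (sigma m : R) (theta thetay : R -> R -> R)
    (Y0 : R -> R) (t : R) : R :=
  - (exp (m * Y0 t) *
    (sigma * (exp (m * Y0 t) - 1) / (m * theta (Y0 t) t) +
     (thetay (Y0 t) t - m * theta (Y0 t) t) / (theta (Y0 t) t) ^ 3)).

Definition I1_integrand (sigma m : R) (L wm : R -> R)
    (theta thetay : R -> R -> R) (Y1 : R -> R) (t : R) : R :=
  exp (m * Y1 t) *
    (sigma * (exp (m * Y1 t) - 1) / (m * theta (Y1 t) t)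
       * (wm t / (2 * L t) - 1) -
     (thetay (Y1 t) t - m * theta (Y1 t) t) / (theta (Y1 t) t) ^ 3).

Definition robin_integrand (sigma m : R) (theta : R -> R -> R)
    (Y0 : R -> R) (t : R) : R :=
  sigma ^ 2 * (exp (m * Y0 t) - 1) ^ 2 / (4 * m ^ 2) -
  sigma * exp (m * Y0 t) / (2 * theta (Y0 t) t).

Definition Y1_bracket (sigma m : R) (L wm Y1 : R -> R) (t : R) : R :=
  - (2 / sigma) * (Derive wm t / wm t) +
  sigma * (exp (m * Y1 t) - 1) ^ 2 / (2 * m ^ 2) * (1 - wm t / L t).

(* [thetay] is theta_y.  The integrals and the arguments of logarithms and
   inverses are required to be meaningful, because [ln] and [/] are total. *)
Record P4_equations (sigma m eps : R) (L v wm h : R -> R)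
    (theta thetay : R -> R -> R) (Y0 Y1 : R -> R) : Prop := {
  P4_dom : forall t, 0 < t -> Y0 t < Y1 t;
  P4_theta_cont : cont2_on (closed_dom Y0 Y1) theta;
  P4_theta_neq0 : forall y t, closed_dom Y0 Y1 (y, t) -> theta y t <> 0;
  P4_thetay : forall y t, open_dom Y0 Y1 (y, t) ->
    is_derive (fun x => theta x t) y (thetay y t);
  P4_thetay_cont : cont2_on (closed_dom Y0 Y1) thetay;
  P4_pde : forall y t, open_dom Y0 Y1 (y, t) ->
    ex_derive (fun tau => theta y tau) t /\
    ex_derive (fun x => / theta x t) y /\
    ex_derive_n (fun x => / theta x t) 2 y /\
    Derive (fun tau => theta y tau) t =
      - Derive_n (fun x => / theta x t) 2 y
      - m * Derive (fun x => / theta x t) y + sigma * exp (m * y);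
  P4_Y1 : forall t, 0 < t ->
    exists I1, is_int_from_0 (I1_integrand sigma m L wm theta thetay Y1) t I1 /\
      0 < 1 + m * I1 /\ Y1 t = ln (1 + m * I1) / m;
  P4_theta_Y1 : forall t, 0 < t ->
    Y1_bracket sigma m L wm Y1 t <> 0 /\
    theta (Y1 t) t = exp (m * Y1 t) * / Y1_bracket sigma m L wm Y1 t;
  P4_robin : forall t, 0 < t ->
    exists J, is_int_from_0 (robin_integrand sigma m theta Y0) t J /\
      h t * v t =
        (h t * eps + sigma * (exp (m * Y0 t) - 1) / (2 * m)) * wm 0 * exp J;
  P4_Y0 : forall t, 0 < t ->
    exists I0, is_int_from_0 (I0_integrand sigma m theta thetay Y0) t I0 /\
      0 < 1 + m * I0 /\ Y0 t = ln (1 + m * I0) / m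
}.

Definition P4_solution (sigma m eps : R) (L v wm h : R -> R)
    (theta : R -> R -> R) (Y0 Y1 : R -> R) : Prop :=
  exists thetay, P4_equations sigma m eps L v wm h theta thetay Y0 Y1.

(* Main.v *)
Require Import Defs.
From Stdlib Require Import Reals Lra Psatz ClassicalEpsilon.
From Coquelicot Require Import Coquelicot.
Open Scope R_scope.

(** The logarithmic derivative [u = w_z / w] solves the Burgers equation
    [u_t = u_zz + 2 u u_z] (Cole-Hopf), and [theta] is [z_y] after the hodograph
    change [exp (m y) = E := 1 - (2 m / sigma) u].  Differentiating [y (z, t)] in [t]
    at fixed [y] gives [z_t = - (1/theta)_y - m / theta + sigma (exp (m y) - 1) / m],
    and the equation for [theta] is the [y]-derivative of this one.  On the two
    boundaries [dE/dt / m] equals the integrands of [I_0] and [I_1], and the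
    integrand of the Robin condition is [w_zz / w = d/dt (ln w (0, t))].

    The equation for [theta] involves [w_zzzz], which the definition of a solution
    does not provide.  A barrier argument gives the gradient bound
    [|v_x| <= 2 sup |v| / r] for the heat equation; applied to differences of
    double difference quotients of [w_z], it shows that the difference quotients
    of [w_zzz] are uniformly Cauchy. *)

(** * The heat equation: maximum principle and interior regularity *)

(** Since [theta_den = w ^ 2 * u_z], the condition [theta_den <> 0] says only that [u_z] does not
    vanish. It is [Y0 < Y1] that selects [u_z < 0], and with it an increasing [y] and a positive
    [theta]. At the lateral boundaries the obstacle is that derivatives exist only inside, while the
    boundary equations differentiate traces in time. Every function is therefore continued
    constantly in [z] past the boundaries: traces become values of functions continuous on a full
    neighbourhood, and derivatives along a boundary are obtained as limits from interior curves. The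
    inverse of [y] meets the same difficulty. Adding [z - clamp] to [y] makes it, for each [t > 0],
    a bijection of the whole line, so that its inverse is continuous across the edges of the strip.
    At [t = 0] only the corner limits are available. They fix the constants of integration: [u -> 0]
    on both boundaries is what makes [1 + m * I] equal to [exp (m * Y)], and [w (0, t) -> w_m (0)]
    is what puts [w_m (0)] into the Robin equation. *)

Lemma is_derive_eps (f : R -> R) (x l : R) :
  is_derive f x l <->
  forall eps, 0 < eps -> exists d, 0 < d /\ forall y, y <> x -> Rabs (y - x) < d ->
    Rabs ((f y - f x) / (y - x) - l) < eps.
Proof.
  rewrite is_derive_Reals; split; intros H eps He.
  - destruct (H eps He) as [[d Hd] Hl]; simpl in Hl.
    exists d; split; [exact Hd|]; intros y Hy Hyd.
    assert (Hne : y - x <> 0) by lra.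
    specialize (Hl (y - x) Hne Hyd).
    now replace (x + (y - x)) with y in Hl by ring.
  - destruct (H eps He) as [d [Hd Hl]].
    exists (mkposreal d Hd); simpl; intros h Hh Hhd.
    assert (Hne : x + h <> x) by lra.
    specialize (Hl (x + h) Hne).
    replace (x + h - x) with h in Hl by ring.
    now apply Hl.
Qed.

Lemma continuity_2d_eps (f : R -> R -> R) (x y : R) :
  continuity_2d_pt f x y <->
  forall eps, 0 < eps -> exists d, 0 < d /\ forall u v,
    Rabs (u - x) < d -> Rabs (v - y) < d -> Rabs (f u v - f x y) < eps.
Proof.
  split; intros H eps.
  - intros He; destruct (H (mkposreal eps He)) as [[d Hd] Hf]; simpl in *; eauto.
  - destruct (H eps (cond_pos eps)) as [d [Hd Hf]].
    exists (mkposreal d Hd); simpl; auto.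
Qed.

Lemma continuity_2d_pt_comp2 (f g k : R -> R -> R) (x y : R) :
  continuity_2d_pt f (g x y) (k x y) ->
  continuity_2d_pt g x y -> continuity_2d_pt k x y ->
  continuity_2d_pt (fun u v => f (g u v) (k u v)) x y.
Proof.
  rewrite !continuity_2d_eps; intros Hf Hg Hk eps He.
  destruct (Hf eps He) as [d [Hd Hfd]].
  destruct (Hg d Hd) as [d1 [Hd1 Hg1]].
  destruct (Hk d Hd) as [d2 [Hd2 Hk2]].
  exists (Rmin d1 d2); split; [now apply Rmin_pos|].
  intros u v Hu Hv.
  pose proof (Rmin_l d1 d2); pose proof (Rmin_r d1 d2).
  apply Hfd; [apply Hg1 | apply Hk2]; lra.
Qed.

Lemma is_derive_affine (f : R -> R) (a b x l : R) :
  is_derive f (a * x + b) l -> is_derive (fun y => f (a * y + b)) x (a * l).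
Proof.
  intros Hf; apply (is_derive_comp f (fun y => a * y + b)); [exact Hf|].
  auto_derive; [exact I|ring].
Qed.

Lemma right_slope_le (f : R -> R) (x l C d : R) :
  is_derive f x l -> 0 < d ->
  (forall y, x < y < x + d -> f y <= f x + C * (y - x)) -> l <= C.
Proof.
  intros Hf Hd Hle; apply Rnot_lt_le; intros HC.
  destruct (proj1 (is_derive_eps f x l) Hf (l - C)) as [e [He H]]; [lra|].
  pose proof (Rmin_l d e); pose proof (Rmin_r d e).
  pose proof (Rmin_pos d e Hd He).
  set (y := x + Rmin d e / 2).
  assert (Hy : x < y < x + d) by (unfold y; lra).
  specialize (Hle y Hy).
  assert (Hyx : Rabs (y - x) < e) by (rewrite Rabs_right; unfold y; lra).
  specialize (H y ltac:(lra) Hyx).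
  apply Rabs_def2 in H.
  assert ((f y - f x) / (y - x) <= C); [|lra].
  apply Rle_div_l; lra.
Qed.

Lemma left_slope_ge (f : R -> R) (x l C d : R) :
  is_derive f x l -> 0 < d ->
  (forall y, x - d < y < x -> f y <= f x + C * (y - x)) -> C <= l.
Proof.
  intros Hf Hd Hle.
  assert (Hr : is_derive (fun y => f (-1 * y + 0)) (- x) (-1 * l)).
  { apply is_derive_affine; replace (-1 * - x + 0) with x by ring; exact Hf. }
  enough (-1 * l <= - C) by lra.
  apply (right_slope_le _ _ _ _ _ Hr Hd); intros y Hy.
  replace (-1 * - x + 0) with x by ring.
  specialize (Hle (-1 * y + 0) ltac:(lra)); lra.
Qed.

(** Right-hand quotients suffice because the derivative is assumed to exist. This carries uniform
    bounds on difference quotients over to derivatives without an explicit limit. *)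
Lemma abs_slope_le (f : R -> R) (x l C d : R) :
  is_derive f x l -> 0 < d ->
  (forall y, x < y < x + d -> Rabs ((f y - f x) / (y - x)) <= C) -> Rabs l <= C.
Proof.
  intros Hf Hd H.
  assert (Hb : forall y, x < y < x + d ->
             - (C * (y - x)) <= f y - f x <= C * (y - x)).
  { intros y Hy; specialize (H y Hy).
    apply Rabs_le_between in H.
    rewrite <- Ropp_mult_distr_l_reverse.
    split; [apply Rle_div_r | apply Rle_div_l]; lra. }
  apply Rabs_le_between; split.
  - apply Ropp_le_cancel; rewrite Ropp_involutive.
    apply (right_slope_le (fun y => - f y) x (- l) C d); auto.
    + now apply (is_derive_opp f).
    + intros y Hy; specialize (Hb y Hy); lra.
  - apply (right_slope_le f x l C d); auto.
    intros y Hy; specialize (Hb y Hy); lra.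
Qed.

(** Left slopes give [f1 x >= 0]. If also [l > 0], then [f1] is positive just to the right of [x],
    and the mean value theorem produces values of [f] above the maximum. *)
Lemma second_derivative_at_max (f f1 : R -> R) (x l d : R) :
  0 < d ->
  (forall y, Rabs (y - x) < d -> is_derive f y (f1 y) /\ f y <= f x) ->
  is_derive f1 x l -> l <= 0.
Proof.
  intros Hd Hf Hf1; apply Rnot_lt_le; intros Hl.
  assert (H0 : 0 <= f1 x).
  { apply (left_slope_ge f x (f1 x) 0 d); auto.
    - apply Hf; rewrite Rminus_diag, Rabs_R0; exact Hd.
    - intros y Hy; destruct (Hf y); [apply Rabs_def1; lra|lra]. }
  destruct (proj1 (is_derive_eps f1 x l) Hf1 l Hl) as [e [He H]].
  pose proof (Rmin_l d e); pose proof (Rmin_r d e).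
  pose proof (Rmin_pos d e Hd He).
  set (y := x + Rmin d e / 2).
  destruct (MVT_cor2 f f1 x y) as [c [Hc1 Hc2]].
  - unfold y; lra.
  - intros c Hc; apply is_derive_Reals, Hf, Rabs_def1; unfold y in Hc; lra.
  - destruct (Hf y) as [_ Hmax]; [apply Rabs_def1; unfold y; lra|].
    specialize (H c ltac:(lra)).
    assert (Hce : Rabs (c - x) < e) by (apply Rabs_def1; unfold y in Hc2; lra).
    specialize (H Hce); apply Rabs_def2 in H.
    assert (Hq : 0 < (f1 c - f1 x) / (c - x)) by lra.
    assert (0 < f1 c - f1 x).
    { replace (f1 c - f1 x) with ((f1 c - f1 x) / (c - x) * (c - x)) by (field; lra).
      apply Rmult_lt_0_compat; lra. }
    assert (0 < f1 c * (y - x)) by (apply Rmult_lt_0_compat; lra).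
    lra.
Qed.

Lemma rectangle_bound (f : R -> R -> R) (a b c d : R) :
  (forall x y, a <= x <= b -> c <= y <= d -> continuity_2d_pt f x y) ->
  exists M, forall x y, a <= x <= b -> c <= y <= d -> f x y <= M.
Proof.
  intros Hf.
  (* The gauge encodes the local bound: near [(u, v)], [f] is at most [1 / delta u v]. *)
  assert (H : forall u v, exists delta : posreal,
             a <= u <= b -> c <= v <= d ->
             forall x y, Rabs (x - u) < delta -> Rabs (y - v) < delta -> f x y <= / delta).
  { intros u v.
    destruct (excluded_middle_informative (a <= u <= b /\ c <= v <= d)) as [[Hu Hv]|Hn].
    2: { exists (mkposreal 1 Rlt_0_1); tauto. }
    destruct (proj1 (continuity_2d_eps f u v) (Hf u v Hu Hv) 1 Rlt_0_1) as [e [He H]].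
    set (N := 1 + Rabs (f u v)).
    assert (HN : 0 < N) by (unfold N; pose proof (Rabs_pos (f u v)); lra).
    assert (Hp : 0 < Rmin e (/ N)) by (apply Rmin_pos; [lra|now apply Rinv_0_lt_compat]).
    exists (mkposreal _ Hp); simpl; intros _ _ x y Hx Hy.
    pose proof (Rmin_l e (/ N)).
    specialize (H x y ltac:(lra) ltac:(lra)).
    apply Rabs_def2 in H.
    apply Rle_trans with N; [unfold N; pose proof (Rle_abs (f u v)); lra|].
    rewrite <- (Rinv_inv N) at 1.
    apply Rinv_le_contravar; [exact Hp|apply Rmin_r]. }
  (* Compactness bounds the gauges that cover the rectangle from below by [e], hence [f] from above
     by [/ e]. It concludes with a double negation, so the bound is proved by contradiction. *)
  destruct (compactness_value_2d a b c d
    (fun u v => proj1_sig (constructive_indefinite_description _ (H u v)))) as [e He].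
  exists (/ e); intros x y Hx Hy.
  apply Rnot_lt_le; intros Hlt.
  apply (He x y Hx Hy); intros (u & v & Hu & Hv & Hxu & Hyv & Hle).
  destruct (constructive_indefinite_description _ (H u v)) as [dl Hdl]; simpl in *.
  specialize (Hdl Hu Hv x y Hxu Hyv).
  assert (/ dl <= / e) by (apply Rinv_le_contravar; [apply cond_pos|exact Hle]).
  lra.
Qed.

(** If the supremum [S] were not attained, [/ (S - f)] would be continuous, hence bounded by some
    [K], and [S - / K] would be a smaller upper bound. *)
Lemma rectangle_max (f : R -> R -> R) (a b c d : R) :
  a <= b -> c <= d ->
  (forall x y, a <= x <= b -> c <= y <= d -> continuity_2d_pt f x y) ->
  exists x0 y0, a <= x0 <= b /\ c <= y0 <= d /\
    forall x y, a <= x <= b -> c <= y <= d -> f x y <= f x0 y0.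
Proof.
  intros Hab Hcd Hf.
  destruct (rectangle_bound f a b c d Hf) as [M HM].
  set (E := fun z => exists x y, a <= x <= b /\ c <= y <= d /\ z = f x y).
  destruct (completeness E) as [S [HS1 HS2]].
  - exists M; intros z (x & y & Hx & Hy & ->); auto.
  - exists (f a c), a, c; repeat split; lra.
  - destruct (excluded_middle_informative
      (exists x0 y0, a <= x0 <= b /\ c <= y0 <= d /\ f x0 y0 = S))
      as [(x0 & y0 & Hx0 & Hy0 & E0)|Hn].
    + exists x0, y0; repeat split; try tauto.
      intros x y Hx Hy; rewrite E0; apply HS1; exists x, y; auto.
    + exfalso.
      assert (Hlt : forall x y, a <= x <= b -> c <= y <= d -> 0 < S - f x y).
      { intros x y Hx Hy.
        assert (f x y <= S) by (apply HS1; exists x, y; auto).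
        destruct (Req_dec (f x y) S) as [e|e]; [|lra].
        exfalso; apply Hn; exists x, y; auto. }
      destruct (rectangle_bound (fun x y => / (S - f x y)) a b c d) as [K HK].
      { intros x y Hx Hy; apply continuity_2d_pt_inv.
        - apply continuity_2d_pt_minus; [apply continuity_2d_pt_const|auto].
        - specialize (Hlt x y Hx Hy); lra. }
      assert (HK0 : 0 < K).
      { apply Rlt_le_trans with (/ (S - f a c)); [|apply HK; lra].
        apply Rinv_0_lt_compat, Hlt; lra. }
      assert (HSK : S <= S - / K).
      { apply HS2; intros z (x & y & Hx & Hy & ->).
        specialize (HK x y Hx Hy); specialize (Hlt x y Hx Hy).
        assert (/ K <= S - f x y); [|lra].
        rewrite <- (Rinv_inv (S - f x y)).
        apply Rinv_le_contravar; [now apply Rinv_0_lt_compat|exact HK]. }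
      pose proof (Rinv_0_lt_compat K HK0); lra.
Qed.

(** A positive maximum lies off the parabolic boundary, so [u_yy <= 0 <= u_t] there, against the
    strict inequality. Since it may lie at [t = b], the sign of [u_t] is read off from earlier times
    only. *)
Lemma strict_maximum_principle (u uy uyy ut : R -> R -> R) (r a b : R) :
  0 < r -> a < b ->
  (forall y t, 0 <= y <= r -> a <= t <= b -> continuity_2d_pt u y t) ->
  (forall y t, 0 < y < r -> a < t <= b ->
     is_derive (fun x => u x t) y (uy y t) /\
     is_derive (fun x => uy x t) y (uyy y t) /\
     is_derive (fun tau => u y tau) t (ut y t) /\ ut y t < uyy y t) ->
  (forall t, a <= t <= b -> u 0 t <= 0 /\ u r t <= 0) ->
  (forall y, 0 <= y <= r -> u y a <= 0) ->
  forall y t, 0 <= y <= r -> a <= t <= b -> u y t <= 0.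
Proof.
  intros Hr Hab Hc Hd Hlat Hini y t Hy Ht.
  destruct (rectangle_max u 0 r a b) as (y0 & t0 & Hy0 & Ht0 & Hmax); try lra; auto.
  apply Rle_trans with (u y0 t0); [auto|].
  apply Rnot_lt_le; intros Hpos.
  assert (Hy0' : 0 < y0 < r).
  { destruct (Hlat t0 Ht0) as [H1 H2].
    split; apply Rnot_le_lt; intros Hle.
    - replace y0 with 0 in Hpos by lra; lra.
    - replace y0 with r in Hpos by lra; lra. }
  assert (Ht0' : a < t0).
  { apply Rnot_le_lt; intros Hle.
    specialize (Hini y0 Hy0); replace t0 with a in Hpos by lra; lra. }
  destruct (Hd y0 t0) as (_ & H2 & H3 & H4); [lra|lra|].
  assert (0 <= ut y0 t0).
  { apply (left_slope_ge _ t0 (ut y0 t0) 0 (t0 - a) H3); [lra|].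
    intros tau Htau; specialize (Hmax y0 tau Hy0 ltac:(lra)); lra. }
  assert (uyy y0 t0 <= 0); [|lra].
  set (e := Rmin y0 (r - y0)).
  assert (He : 0 < e) by (apply Rmin_pos; lra).
  pose proof (Rmin_l y0 (r - y0)); pose proof (Rmin_r y0 (r - y0)); fold e in H0, H1.
  apply (second_derivative_at_max (fun x => u x t0) (fun x => uy x t0) y0 _ e He); auto.
  intros z Hz; apply Rabs_def2 in Hz; split.
  - apply Hd; lra.
  - apply Hmax; lra.
Qed.

Lemma is_derive_eq (f : R -> R) (x a b : R) : is_derive f x a -> a = b -> is_derive f x b.
Proof. now intros H <-. Qed.

Lemma is_derive_shift (f : R -> R) (a x l : R) :
  is_derive f (x + a) l -> is_derive (fun y => f (y + a)) x l.
Proof.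
  intros Hf; rewrite <- (Rmult_1_l l).
  apply (is_derive_ext (fun y => f (1 * y + a))); [intros y; f_equal; ring|].
  apply is_derive_affine; now rewrite Rmult_1_l.
Qed.

Lemma is_derive_Rminus (f g : R -> R) (x a b : R) :
  is_derive f x a -> is_derive g x b -> is_derive (fun y => f y - g y) x (a - b).
Proof. exact (is_derive_minus f g x a b). Qed.

Lemma is_derive_Rplus (f g : R -> R) (x a b : R) :
  is_derive f x a -> is_derive g x b -> is_derive (fun y => f y + g y) x (a + b).
Proof. exact (is_derive_plus f g x a b). Qed.

Lemma is_derive_Rdiv (f : R -> R) (c x a : R) :
  is_derive f x a -> is_derive (fun y => f y / c) x (a / c).
Proof.
  intros H; apply (is_derive_ext (fun y => / c * f y)); [intros; apply Rmult_comm|].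
  unfold Rdiv; rewrite Rmult_comm; exact (is_derive_scal f x (/ c) a H).
Qed.

Lemma continuity_2d_pt_of_cont (f : R -> R) (x y : R) :
  continuous f x -> continuity_2d_pt (fun u _ => f u) x y.
Proof.
  intros Hf; apply (continuity_1d_2d_pt_comp f (fun u _ => u)).
  - now apply continuity_pt_filterlim.
  - apply continuity_2d_pt_id1.
Qed.

(* The odd part of [v] about [x0] vanishes on the axis; comparing it with the
   strict supersolution [B] of the heat equation, which is nonnegative at [y = 0]
   and at least [2 * M] on the rest of the parabolic boundary, bounds its slope. *)
Lemma heat_gradient_upper (v vx vxx : R -> R -> R) (x0 t0 r M : R) :
  0 < r -> 0 < M ->
  (forall x t, Rabs (x - x0) <= r -> t0 - r ^ 2 <= t <= t0 ->
     continuity_2d_pt v x t /\ Rabs (v x t) <= M /\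
     is_derive (fun y => v y t) x (vx x t) /\
     is_derive (fun y => vx y t) x (vxx x t) /\
     is_derive (fun tau => v x tau) t (vxx x t)) ->
  vx x0 t0 <= 2 * M / r.
Proof.
  intros Hr HM Hv.
  assert (Hr2 : 0 < r ^ 2) by (apply pow_lt; exact Hr).
  (* [B_t = - 2 * M / r ^ 2] exceeds [B_yy = - 4 * M / r ^ 2]. The first term supplies [2 * M] at
     the initial time, the other two supply it at [y = r]. At [t = t0] the slope of [B] at [0] is
     [4 * M / r], while that of the odd part is [2 * vx x0 t0]. *)
  set (B := fun y t => 2 * M * ((t0 - t) / r ^ 2 + 2 * (y / r) - (y / r) ^ 2)).
  set (u := fun y t => v (1 * y + x0) t - v (-1 * y + x0) t - B y t).
  assert (Hp : forall y, 0 <= y <= r -> Rabs (1 * y + x0 - x0) <= r)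
    by (intros; apply Rabs_le; lra).
  assert (Hn : forall y, 0 <= y <= r -> Rabs (-1 * y + x0 - x0) <= r)
    by (intros; apply Rabs_le; lra).
  assert (Hq : forall y, 0 <= y <= r -> 0 <= y / r <= 1).
  { intros y Hy; split; [apply Rle_div_r; lra|apply Rle_div_l; lra]. }
  assert (Hu : forall y t, 0 <= y <= r -> t0 - r ^ 2 <= t <= t0 -> u y t <= 0).
  { apply (strict_maximum_principle u
      (fun y t => 1 * vx (1 * y + x0) t - -1 * vx (-1 * y + x0) t
                  - 2 * M * (2 / r - 2 * y / r ^ 2))
      (fun y t => 1 * (1 * vxx (1 * y + x0) t) - -1 * (-1 * vxx (-1 * y + x0) t)
                  - 2 * M * (0 - 2 / r ^ 2))
      (fun y t => vxx (1 * y + x0) t - vxx (-1 * y + x0) t - 2 * M * (- / r ^ 2))); try lra.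
    - intros y t Hy Ht; unfold u, B.
      repeat apply continuity_2d_pt_minus.
      + apply (continuity_2d_pt_comp2 v (fun y _ => 1 * y + x0) (fun _ t => t)).
        * apply Hv; auto.
        * apply (continuity_2d_pt_of_cont (fun y => 1 * y + x0)).
          apply (ex_derive_continuous (fun y : R => 1 * y + x0)); auto_derive; exact I.
        * apply continuity_2d_pt_id2.
      + apply (continuity_2d_pt_comp2 v (fun y _ => -1 * y + x0) (fun _ t => t)).
        * apply Hv; auto.
        * apply (continuity_2d_pt_of_cont (fun y => -1 * y + x0)).
          apply (ex_derive_continuous (fun y : R => -1 * y + x0)); auto_derive; exact I.
        * apply continuity_2d_pt_id2.
      + apply continuity_2d_pt_mult; [apply continuity_2d_pt_const|].
        apply continuity_2d_pt_minus; [apply continuity_2d_pt_plus|].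
        * apply continuity_2d_pt_mult; [|apply continuity_2d_pt_const].
          apply continuity_2d_pt_minus;
            [apply continuity_2d_pt_const|apply continuity_2d_pt_id2].
        * apply (continuity_2d_pt_of_cont (fun y => 2 * (y / r))).
          apply (ex_derive_continuous (fun y : R => 2 * (y / r))); auto_derive; lra.
        * apply (continuity_2d_pt_of_cont (fun y => (y / r) ^ 2)).
          apply (ex_derive_continuous (fun y : R => (y / r) ^ 2)); auto_derive; lra.
    - intros y t Hy Ht.
      destruct (Hv (1 * y + x0) t) as (_ & _ & P1 & P2 & P3); [apply Hp; lra|lra|].
      destruct (Hv (-1 * y + x0) t) as (_ & _ & N1 & N2 & N3); [apply Hn; lra|lra|].
      split; [|split; [|split]].
      + unfold u; apply is_derive_Rminus; [apply is_derive_Rminus|].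
        * exact (is_derive_affine (fun x => v x t) 1 x0 y _ P1).
        * exact (is_derive_affine (fun x => v x t) (-1) x0 y _ N1).
        * unfold B; auto_derive; [lra|field; lra].
      + apply is_derive_Rminus; [apply is_derive_Rminus|].
        * apply (is_derive_scal (fun y => vx (1 * y + x0) t)).
          exact (is_derive_affine (fun x => vx x t) 1 x0 y _ P2).
        * apply (is_derive_scal (fun y => vx (-1 * y + x0) t)).
          exact (is_derive_affine (fun x => vx x t) (-1) x0 y _ N2).
        * auto_derive; [lra|field; lra].
      + unfold u; apply is_derive_Rminus; [apply is_derive_Rminus|]; auto.
        unfold B; auto_derive; [lra|field; lra].
      + assert (0 < 2 * M * / r ^ 2).
        { apply Rmult_lt_0_compat; [lra|now apply Rinv_0_lt_compat]. }
        unfold Rdiv; lra.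
    - assert (HB : forall t, t0 - r ^ 2 <= t <= t0 -> 0 <= (t0 - t) / r ^ 2).
      { intros t Ht; apply Rle_div_r; lra. }
      intros t Ht; specialize (HB t Ht); unfold u, B; split.
      + replace (-1 * 0 + x0) with (1 * 0 + x0) by ring.
        replace (0 / r) with 0 by (field; lra).
        enough (0 <= 2 * M * ((t0 - t) / r ^ 2)) by nra.
        apply Rmult_le_pos; lra.
      + destruct (Hv (1 * r + x0) t) as (_ & P & _); [apply Hp; lra|lra|].
        destruct (Hv (-1 * r + x0) t) as (_ & N & _); [apply Hn; lra|lra|].
        apply Rabs_le_between in P; apply Rabs_le_between in N.
        replace (r / r) with 1 by (field; lra).
        assert (2 * M * 1 <= 2 * M * ((t0 - t) / r ^ 2 + 2 * 1 - 1 ^ 2))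
          by (apply Rmult_le_compat_l; lra).
        lra.
    - intros y Hy; unfold u, B.
      destruct (Hv (1 * y + x0) (t0 - r ^ 2)) as (_ & P & _); [apply Hp; lra|lra|].
      destruct (Hv (-1 * y + x0) (t0 - r ^ 2)) as (_ & N & _); [apply Hn; lra|lra|].
      apply Rabs_le_between in P; apply Rabs_le_between in N.
      replace ((t0 - (t0 - r ^ 2)) / r ^ 2) with 1 by (field; lra).
      assert (2 * M * 1 <= 2 * M * (1 + 2 * (y / r) - (y / r) ^ 2)).
      { apply Rmult_le_compat_l; [lra|]; specialize (Hq y Hy); nra. }
      lra. }
  assert (Hd : is_derive (fun y => v (1 * y + x0) t0 - v (-1 * y + x0) t0) 0 (2 * vx x0 t0)).
  { apply is_derive_eq with (1 * vx x0 t0 - -1 * vx x0 t0); [|ring].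
    apply is_derive_Rminus.
    - apply (is_derive_affine (fun x => v x t0)).
      replace (1 * 0 + x0) with x0 by ring.
      apply Hv; [rewrite Rminus_diag, Rabs_R0|]; lra.
    - apply (is_derive_affine (fun x => v x t0)).
      replace (-1 * 0 + x0) with x0 by ring.
      apply Hv; [rewrite Rminus_diag, Rabs_R0|]; lra. }
  enough (2 * vx x0 t0 <= 2 * M * (2 / r)) by (unfold Rdiv in *; lra).
  apply (right_slope_le _ 0 _ _ r Hd Hr); intros y Hy.
  specialize (Hu y t0 ltac:(lra) ltac:(lra)); unfold u, B in Hu.
  replace (-1 * 0 + x0) with (1 * 0 + x0) by ring.
  replace ((t0 - t0) / r ^ 2) with 0 in Hu by (field; lra).
  assert (0 <= 2 * M * (y / r) ^ 2).
  { apply Rmult_le_pos; [lra|apply pow2_ge_0]. }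
  replace (2 * M * (2 / r) * (y - 0)) with (2 * M * (2 * (y / r))) by (field; lra).
  lra.
Qed.

Lemma heat_gradient (v vx vxx : R -> R -> R) (x0 t0 r M : R) :
  0 < r -> 0 < M ->
  (forall x t, Rabs (x - x0) <= r -> t0 - r ^ 2 <= t <= t0 ->
     continuity_2d_pt v x t /\ Rabs (v x t) <= M /\
     is_derive (fun y => v y t) x (vx x t) /\
     is_derive (fun y => vx y t) x (vxx x t) /\
     is_derive (fun tau => v x tau) t (vxx x t)) ->
  Rabs (vx x0 t0) <= 2 * M / r.
Proof.
  intros Hr HM Hv; apply Rabs_le; split.
  - enough (- vx x0 t0 <= 2 * M / r) by lra.
    apply (heat_gradient_upper (fun x t => - v x t) (fun x t => - vx x t)
      (fun x t => - vxx x t)); auto.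
    intros x t Hx Ht; destruct (Hv x t Hx Ht) as (H1 & H2 & H3 & H4 & H5).
    split; [|split; [|split; [|split]]].
    + now apply continuity_2d_pt_opp.
    + now rewrite Rabs_Ropp.
    + now apply (is_derive_opp (fun y => v y t)).
    + now apply (is_derive_opp (fun y => vx y t)).
    + now apply (is_derive_opp (fun tau => v x tau)).
  - now apply (heat_gradient_upper v vx vxx x0 t0 r M).
Qed.

(** * Difference quotients and the gain of one space derivative *)

Definition dq (h : R) (f : R -> R -> R) (x t : R) : R := (f (x + h) t - f x t) / h.

Lemma is_derive_dq (h : R) (f g : R -> R -> R) (x t : R) :
  is_derive (fun y => f y t) x (g x t) ->
  is_derive (fun y => f y t) (x + h) (g (x + h) t) ->
  is_derive (fun y => dq h f y t) x (dq h g x t).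
Proof.
  intros H1 H2; unfold dq.
  apply is_derive_Rdiv, is_derive_Rminus; [|exact H1].
  now apply (is_derive_shift (fun y => f y t)).
Qed.

Lemma is_derive_dq_time (h : R) (f g : R -> R -> R) (x t : R) :
  is_derive (fun tau => f x tau) t (g x t) ->
  is_derive (fun tau => f (x + h) tau) t (g (x + h) t) ->
  is_derive (fun tau => dq h f x tau) t (dq h g x t).
Proof. intros H1 H2; unfold dq; now apply is_derive_Rdiv, is_derive_Rminus. Qed.

Lemma continuity_2d_pt_dq (h : R) (f : R -> R -> R) (x t : R) :
  continuity_2d_pt f x t -> continuity_2d_pt f (x + h) t ->
  continuity_2d_pt (dq h f) x t.
Proof.
  intros H1 H2; unfold dq, Rdiv.
  apply continuity_2d_pt_mult; [|apply continuity_2d_pt_const].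
  apply continuity_2d_pt_minus; [|exact H1].
  apply (continuity_2d_pt_comp2 f (fun u _ => u + h) (fun _ v => v)); auto.
  - apply continuity_2d_pt_plus; [apply continuity_2d_pt_id1|apply continuity_2d_pt_const].
  - apply continuity_2d_pt_id2.
Qed.

Lemma dq_mean_value (h : R) (f g : R -> R -> R) (x t : R) :
  h <> 0 ->
  (forall y, Rabs (y - x) <= Rabs h -> is_derive (fun y => f y t) y (g y t)) ->
  exists xi, Rabs (xi - x) <= Rabs h /\ dq h f x t = g xi t.
Proof.
  intros Hh Hf.
  destruct (MVT_cor4 (fun y => f y t) (fun y => g y t) x (Rabs h) Hf (x + h))
    as [c [Hc1 Hc2]].
  - replace (x + h - x) with h by ring; lra.
  - replace (x + h - x) with h in * by ring.
    exists c; split; [exact Hc2|].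
    unfold dq; rewrite Hc1; now field.
Qed.

(** With double quotients expressed as nearby values of [k], uniform continuity of [k] controls the
    difference of two of them uniformly in the increments. *)
Lemma dq_dq_mean_value (l h : R) (f g k : R -> R -> R) (x t : R) :
  l <> 0 -> h <> 0 ->
  (forall y, Rabs (y - x) <= Rabs l + Rabs h ->
     is_derive (fun y => f y t) y (g y t) /\ is_derive (fun y => g y t) y (k y t)) ->
  exists xi, Rabs (xi - x) <= Rabs l + Rabs h /\ dq l (dq h f) x t = k xi t.
Proof.
  intros Hl Hh H.
  destruct (dq_mean_value l (dq h f) (dq h g) x t Hl) as [c [Hc1 Hc2]].
  - intros y Hy; apply is_derive_dq; apply H.
    + pose proof (Rabs_pos h); lra.
    + replace (y + h - x) with (y - x + h) by ring.
      pose proof (Rabs_triang (y - x) h); lra.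
  - destruct (dq_mean_value h g k c t Hh) as [xi [Hx1 Hx2]].
    + intros y Hy; apply H.
      replace (y - x) with (c - x + (y - c)) by ring.
      pose proof (Rabs_triang (c - x) (y - c)); lra.
    + exists xi; split; [|congruence].
      replace (xi - x) with (c - x + (xi - c)) by ring.
      pose proof (Rabs_triang (c - x) (xi - c)); lra.
Qed.

(* [dq l (dq h f) - dq l (dq h' f)] solves the heat equation and tends to [0]
   uniformly, so by the interior gradient bound its space derivative does too. *)
Lemma heat_dq_cauchy (f g k : R -> R -> R) (x0 t0 r : R) :
  0 < r <= 1 ->
  (forall x t, Rabs (x - x0) <= 3 * r -> Rabs (t - t0) <= 3 * r ->
     continuity_2d_pt f x t /\ continuity_2d_pt k x t /\
     is_derive (fun y => f y t) x (g x t) /\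
     is_derive (fun y => g y t) x (k x t) /\
     is_derive (fun tau => f x tau) t (k x t)) ->
  forall eps, 0 < eps -> exists eta, 0 < eta /\
    forall x t, Rabs (x - x0) < r -> Rabs (t - t0) < r ->
    forall h h', h <> 0 -> Rabs h < eta -> h' <> 0 -> Rabs h' < eta ->
      Rabs (dq h k x t - dq h' k x t) <= eps.
Proof.
  intros Hr H eps He.
  (* With [M = eps * r / 2] the gradient bound [2 * M / r] is exactly [eps]. *)
  assert (HM : 0 < eps * r / 2) by (apply Rdiv_lt_0_compat; [apply Rmult_lt_0_compat|]; lra).
  assert (Hunif := uniform_continuity_2d k (x0 - 3 * r) (x0 + 3 * r) (t0 - 3 * r) (t0 + 3 * r)).
  destruct Hunif with (eps := mkposreal _ HM) as [[eta0 Heta0] Hk]; simpl in *.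
  { intros x t Hx Ht; apply H; apply Rabs_le; lra. }
  (* Two mean value points, each within [2 * eta] of a common [z], are then less than [eta0] apart,
     and all points stay in the box of half-width [3 * r]. *)
  set (eta := Rmin eta0 r / 4).
  assert (Heta : 0 < eta) by (unfold eta; pose proof (Rmin_pos eta0 r Heta0); lra).
  assert (Heta1 : 4 * eta <= eta0) by (unfold eta; pose proof (Rmin_l eta0 r); lra).
  assert (Heta2 : 4 * eta <= r) by (unfold eta; pose proof (Rmin_r eta0 r); lra).
  assert (Hr2 : 0 <= r ^ 2 <= r) by nra.
  exists eta; split; [exact Heta|].
  intros x t Hx Ht h h' Hh0 Hh Hh'0 Hh'.
  apply Rabs_def2 in Hx; apply Rabs_def2 in Ht.
  pose proof (Rabs_def2 _ _ Hh); pose proof (Rabs_def2 _ _ Hh').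
  assert (Hx0 : Rabs (x - x0) <= 3 * r) by (apply Rabs_le; lra).
  assert (Ht0 : Rabs (t - t0) <= 3 * r) by (apply Rabs_le; lra).
  (* [dq h k] is the space derivative of [dq h g], but [g] is not known to solve the heat equation.
     The solution [dq l f] replaces [g], and [abs_slope_le] performs the limit [l -> 0]. *)
  apply (abs_slope_le (fun y => dq h g y t - dq h' g y t) x _ _ eta); [|exact Heta|].
  { apply is_derive_Rminus; apply is_derive_dq; apply H; auto; apply Rabs_le; lra. }
  intros y Hy.
  set (l := y - x); assert (Hl : 0 < l < eta) by (unfold l; lra).
  assert (Hla : Rabs l = l) by (apply Rabs_right; lra).
  replace ((dq h g y t - dq h' g y t - (dq h g x t - dq h' g x t)) / l)
    with (dq l (dq h g) x t - dq l (dq h' g) x t).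
  2: { unfold dq at 1 3; replace (x + l) with y by (unfold l; ring).
       field; lra. }
  replace eps with (2 * (eps * r / 2) / r) by (field; lra).
  apply (heat_gradient
    (fun x t => dq l (dq h f) x t - dq l (dq h' f) x t)
    (fun x t => dq l (dq h g) x t - dq l (dq h' g) x t)
    (fun x t => dq l (dq h k) x t - dq l (dq h' k) x t)); [lra|exact HM|].
  intros z tau Hz Htau.
  apply Rabs_le_between in Hz.
  assert (Htau' : Rabs (tau - t0) <= 3 * r) by (apply Rabs_le; lra).
  assert (Hin2 : forall y, Rabs (y - z) <= 2 * eta -> Rabs (y - x0) <= 3 * r).
  { intros a Ha; apply Rabs_le_between in Ha; apply Rabs_le; lra. }
  assert (Hz0 : Rabs (z - x0) <= 3 * r) by (apply Rabs_le; lra).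
  assert (Hl1 : Rabs (z + l - x0) <= 3 * r) by (apply Rabs_le; lra).
  assert (Hh1 : Rabs (z + h - x0) <= 3 * r) by (apply Rabs_le; lra).
  assert (Hh'1 : Rabs (z + h' - x0) <= 3 * r) by (apply Rabs_le; lra).
  assert (Hlh1 : Rabs (z + l + h - x0) <= 3 * r) by (apply Rabs_le; lra).
  assert (Hlh'1 : Rabs (z + l + h' - x0) <= 3 * r) by (apply Rabs_le; lra).
  split; [|split; [|split; [|split]]].
  - apply continuity_2d_pt_minus; apply continuity_2d_pt_dq;
      apply continuity_2d_pt_dq; apply H; auto.
  - destruct (dq_dq_mean_value l h f g k z tau) as [xi [Hxi ->]]; [lra|exact Hh0| |].
    { intros a Ha; split; apply H; auto; apply Hin2; lra. }
    destruct (dq_dq_mean_value l h' f g k z tau) as [xi' [Hxi' ->]]; [lra|exact Hh'0| |].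
    { intros a Ha; split; apply H; auto; apply Hin2; lra. }
    apply Rabs_le_between in Hxi; apply Rabs_le_between in Hxi'.
    left; apply Hk; try lra.
    + apply Rabs_def1; lra.
    + rewrite Rminus_diag, Rabs_R0; exact Heta0.
  - apply is_derive_Rminus; apply is_derive_dq; apply is_derive_dq; apply H; auto.
  - apply is_derive_Rminus; apply is_derive_dq; apply is_derive_dq; apply H; auto.
  - apply is_derive_Rminus; apply is_derive_dq_time; apply is_derive_dq_time; apply H; auto.
Qed.

(** The Cauchy estimate is uniform near the point: completeness gives the derivative of [k], and as
    a uniform limit of the continuous functions [dq h k] it is continuous. *)
Lemma heat_extra_derivative (f g k : R -> R -> R) (x0 t0 : R) :
  locally_2d (fun x t =>
     continuity_2d_pt f x t /\ continuity_2d_pt k x t /\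
     is_derive (fun y => f y t) x (g x t) /\
     is_derive (fun y => g y t) x (k x t) /\
     is_derive (fun tau => f x tau) t (k x t)) x0 t0 ->
  locally_2d (fun x t => ex_derive (fun y => k y t) x) x0 t0 /\
  continuity_2d_pt (fun x t => Derive (fun y => k y t) x) x0 t0.
Proof.
  intros [[d Hd] H]; simpl in H.
  set (r := Rmin d 1 / 4).
  assert (Hr : 0 < r <= 1).
  { unfold r; pose proof (Rmin_pos d 1 Hd Rlt_0_1); pose proof (Rmin_r d 1); lra. }
  assert (Hrd : 4 * r <= d) by (unfold r; pose proof (Rmin_l d 1); lra).
  assert (HC := heat_dq_cauchy f g k x0 t0 r Hr).
  assert (HC' := HC ltac:(intros; apply H; lra)); clear HC.
  assert (Hex : forall x t, Rabs (x - x0) < r -> Rabs (t - t0) < r ->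
                  ex_derive (fun y => k y t) x).
  { intros x t Hx Ht.
    destruct (proj1 (filterlim_locally_cauchy (F := Rbar_locally' 0) (fun h => dq h k x t)))
      as [l Hl].
    - intros [e He].
      destruct (HC' (e / 2)) as [eta [Heta Hc]]; [lra|].
      exists (fun h => h <> 0 /\ Rabs h < eta); split.
      + exists (mkposreal _ Heta); intros h Hh Hh0; split; [exact Hh0|].
        change (Rabs (h - 0) < eta) in Hh; now rewrite Rminus_0_r in Hh.
      + intros u v [Hu Hu'] [Hv Hv'].
        change (Rabs (dq v k x t - dq u k x t) < e).
        apply Rle_lt_trans with (e / 2); [|lra].
        now apply Hc.
    - exists l; apply is_derive_eps; intros e He.
      destruct (proj1 (filterlim_locally _ _) Hl (mkposreal e He)) as [[eta Heta] Hb].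
      exists eta; split; [exact Heta|]; intros y Hy Hyx.
      assert (Hb' : Rabs (dq (y - x) k x t - l) < e).
      { apply (Hb (y - x)); [|lra].
        change (Rabs (y - x - 0) < eta); now rewrite Rminus_0_r. }
      unfold dq in Hb'; now replace (x + (y - x)) with y in Hb' by ring. }
  split.
  { exists (mkposreal r (proj1 Hr)); simpl; intros x t Hx Ht; now apply Hex. }
  apply continuity_2d_eps; intros e He.
  destruct (HC' (e / 4)) as [eta [Heta Hc]]; [lra|].
  set (h := Rmin eta r / 2).
  assert (Hh : 0 < h) by (unfold h; pose proof (Rmin_pos eta r Heta); lra).
  assert (Hh1 : h < eta) by (unfold h in *; pose proof (Rmin_l eta r); lra).
  assert (Hh2 : h < r) by (unfold h in *; pose proof (Rmin_r eta r); lra).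
  assert (Happ : forall x t, Rabs (x - x0) < r -> Rabs (t - t0) < r ->
             Rabs (Derive (fun y => k y t) x - dq h k x t) <= e / 4).
  { intros x t Hx Ht.
    (* The slopes of this function are the differences [dq (y - x) k x t - dq h k x t], so the
       Cauchy bound survives the limit [y -> x]. *)
    apply (abs_slope_le (fun y => k y t - dq h k x t * y) x _ _ eta); [|exact Heta|].
    - apply is_derive_Rminus; [now apply Derive_correct, Hex|].
      auto_derive; [exact I|ring].
    - intros y Hy.
      replace ((k y t - dq h k x t * y - (k x t - dq h k x t * x)) / (y - x))
        with (dq (y - x) k x t - dq h k x t).
      + apply Hc; auto; try lra; rewrite Rabs_right; lra.
      + unfold dq at 1; replace (x + (y - x)) with y by ring; field; lra. }
  assert (Hcont : continuity_2d_pt (dq h k) x0 t0).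
  { apply continuity_2d_pt_dq; apply H; rewrite ?Rminus_diag, ?Rabs_R0; try lra.
    apply Rabs_def1; lra. }
  destruct (proj1 (continuity_2d_eps _ _ _) Hcont (e / 4)) as [d' [Hd' Hq]]; [lra|].
  exists (Rmin d' r); split; [apply Rmin_pos; lra|].
  pose proof (Rmin_l d' r); pose proof (Rmin_r d' r).
  intros x t Hx Ht.
  specialize (Hq x t ltac:(lra) ltac:(lra)).
  pose proof (Happ x t ltac:(lra) ltac:(lra)) as A1.
  assert (A2 := Happ x0 t0); rewrite !Rminus_diag, !Rabs_R0 in A2.
  specialize (A2 ltac:(lra) ltac:(lra)).
  apply Rabs_le_between in A1; apply Rabs_le_between in A2; apply Rabs_def2 in Hq.
  apply Rabs_def1; lra.
Qed.

(** Schwarz's theorem in the form that also yields the existence of the second mixed derivative. Two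
    mean value theorems turn the double difference of [f] into [ftx z tau * (s - t) * (y - x)]; [y]
    goes to [x] first, with [s] fixed. *)
Lemma swap_derivatives (f fx ft ftx : R -> R -> R) (x t : R) :
  locally_2d (fun y tau => is_derive (fun z => f z tau) y (fx y tau) /\
     is_derive (fun s => f y s) tau (ft y tau) /\
     is_derive (fun z => ft z tau) y (ftx y tau)) x t ->
  continuity_2d_pt ftx x t ->
  is_derive (fun s => fx x s) t (ftx x t).
Proof.
  intros [[d Hd] H] Hc; simpl in H.
  apply is_derive_eps; intros e He.
  destruct (proj1 (continuity_2d_eps _ _ _) Hc (e / 2)) as [d' [Hd' Hq]]; [lra|].
  set (r := Rmin d d').
  assert (Hr : 0 < r) by now apply Rmin_pos.
  assert (Hrd : r <= d) by apply Rmin_l.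
  assert (Hrd' : r <= d') by apply Rmin_r.
  assert (Hself : forall a, Rabs (a - a) < r) by (intros; rewrite Rminus_diag, Rabs_R0; lra).
  exists r; split; [exact Hr|]; intros s Hs Hst.
  assert (Hst' := Rabs_def2 _ _ Hst).
  apply Rle_lt_trans with (e / 2); [|lra].
  apply (abs_slope_le
    (fun y => (f y s - f y t) / (s - t) - ftx x t * y) x _ _ r); [|exact Hr|].
  { apply is_derive_Rminus.
    - apply is_derive_Rdiv, is_derive_Rminus; apply H; specialize (Hself x);
        try specialize (Hself t); try lra.
      rewrite Rminus_diag, Rabs_R0; lra.
    - auto_derive; [exact I|ring]. }
  intros y Hy.
  assert (Hyx : Rabs (y - x) < r) by (apply Rabs_def1; lra).
  destruct (MVT_cor4 (fun tau => f y tau - f x tau) (fun tau => ft y tau - ft x tau)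
     t (Rabs (s - t))) with (b := s) as [tau [Hm1 Hm2]]; [|lra|].
  { intros tau Htau; apply is_derive_Rminus; apply H; specialize (Hself x); lra. }
  destruct (MVT_cor4 (fun z => ft z tau) (fun z => ftx z tau) x (Rabs (y - x)))
    with (b := y) as [z [Hz1 Hz2]]; [|lra|].
  { intros z Hz; apply H; lra. }
  specialize (Hq z tau ltac:(lra) ltac:(lra)).
  replace (((f y s - f y t) / (s - t) - ftx x t * y -
            ((f x s - f x t) / (s - t) - ftx x t * x)) / (y - x))
    with (ftx z tau - ftx x t); [lra|].
  apply Rmult_eq_reg_r with ((s - t) * (y - x)).
  2: { apply Rmult_integral_contrapositive_currified; lra. }
  replace ((((f y s - f y t) / (s - t) - ftx x t * y -
            ((f x s - f x t) / (s - t) - ftx x t * x)) / (y - x)) * ((s - t) * (y - x)))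
    with ((f y s - f x s) - (f y t - f x t) - ftx x t * ((s - t) * (y - x))) by (field; lra).
  rewrite Hm1, Hz1; ring.
Qed.

(** * Functions on the moving domain and their boundary traces *)

Lemma differentiable_of_partials (f fz : R -> R -> R) (z t ft : R) :
  locally_2d (fun a b => is_derive (fun x => f x b) a (fz a b)) z t ->
  continuity_2d_pt fz z t ->
  is_derive (fun tau => f z tau) t ft ->
  differentiable_pt_lim f z t (fz z t) ft.
Proof.
  intros Hz Hc Ht; apply filterdiff_differentiable_pt_lim.
  apply (is_derive_filterdiff f z t fz ft); auto.
  - now apply (locally_2d_locally (fun a b => is_derive (fun x => f x b) a (fz a b))).
  - now apply (continuity_2d_pt_filterlim fz).
Qed.

Lemma chain_rule_curve (f fz : R -> R -> R) (c : R -> R) (t ft dc : R) :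
  locally_2d (fun a b => is_derive (fun x => f x b) a (fz a b)) (c t) t ->
  continuity_2d_pt fz (c t) t ->
  is_derive (fun tau => f (c t) tau) t ft ->
  is_derive c t dc ->
  is_derive (fun tau => f (c tau) tau) t (fz (c t) t * dc + ft).
Proof.
  intros Hz Hc Ht Hdc; rewrite <- (Rmult_1_r ft); apply is_derive_Reals.
  apply (derivable_pt_lim_comp_2d f c (fun tau => tau)).
  - now apply differentiable_of_partials.
  - now apply is_derive_Reals.
  - apply derivable_pt_lim_id.
Qed.

(* Used with [(k, l) = (1, 0)] and [(0, 1)]: the derivatives of the inverse
   [Z y t] of [F] with respect to [y] and to [t]. *)
Lemma implicit_derive (F : R -> R -> R) (zeta tau : R -> R) (x0 p q k l : R) :
  differentiable_pt_lim F (zeta x0) (tau x0) p q -> p <> 0 -> Rabs l <= 1 ->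
  continuous zeta x0 ->
  locally x0 (fun x => F (zeta x) (tau x) - F (zeta x0) (tau x0) = k * (x - x0) /\
                       tau x - tau x0 = l * (x - x0)) ->
  is_derive zeta x0 ((k - q * l) / p).
Proof.
  intros HF Hp Hl Hz [[d Hd] HL].
  set (L := (k - q * l) / p).
  assert (HLp : L * p = k - q * l) by (unfold L; field; exact Hp).
  clearbody L.
  apply is_derive_eps; intros eps Heps.
  assert (Hp' : 0 < Rabs p) by now apply Rabs_pos_lt.
  assert (HK : 0 < Rabs L + 1) by (pose proof (Rabs_pos L); lra).
  (* The linearization error involves the unknown increment of [zeta]. The first bound on [e] lets
     that part be absorbed into [Rabs p * D]; the second makes the rest at most [eps / 2 * X]. *)
  set (e := Rmin (Rabs p / 2) (eps * Rabs p / (4 * (Rabs L + 1)))).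
  assert (He : 0 < e).
  { apply Rmin_pos; [lra|]; apply Rdiv_lt_0_compat; [now apply Rmult_lt_0_compat|lra]. }
  assert (He1 : e <= Rabs p / 2) by apply Rmin_l.
  assert (He2 : e * (4 * (Rabs L + 1)) <= eps * Rabs p).
  { apply Rle_div_r; [lra|apply Rmin_r]. }
  clearbody e.
  destruct (HF (mkposreal e He)) as [[d1 Hd1] H1]; simpl in H1.
  destruct (proj1 (filterlim_locally _ _) Hz (mkposreal d1 Hd1)) as [[d2 Hd2] H2].
  exists (Rmin d (Rmin d1 d2)); split; [repeat apply Rmin_pos; assumption|].
  intros x Hx Hxd.
  pose proof (Rmin_l d (Rmin d1 d2)); pose proof (Rmin_r d (Rmin d1 d2)).
  pose proof (Rmin_l d1 d2); pose proof (Rmin_r d1 d2).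
  assert (Hz2 : Rabs (zeta x - zeta x0) < d1) by (apply (H2 x); change (Rabs (x - x0) < d2); lra).
  destruct (HL x) as [E1 E2]; [change (Rabs (x - x0) < d); lra|].
  assert (Htau : Rabs (tau x - tau x0) <= Rabs (x - x0)).
  { rewrite E2, Rabs_mult; pose proof (Rabs_pos (x - x0)); nra. }
  specialize (H1 (zeta x) (tau x) Hz2 ltac:(lra)).
  rewrite E1, E2 in H1.
  replace (k * (x - x0) - (p * (zeta x - zeta x0) + q * (l * (x - x0))))
    with (- (p * ((zeta x - zeta x0) - L * (x - x0)))) in H1.
  2: { replace (k * (x - x0)) with (L * p * (x - x0) + q * l * (x - x0))
         by (rewrite HLp; ring); ring. }
  rewrite Rabs_Ropp, Rabs_mult, <- E2 in H1.
  assert (Hx0 : 0 < Rabs (x - x0)) by (apply Rabs_pos_lt; lra).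
  set (X := Rabs (x - x0)) in *.
  assert (HZ : Rabs (zeta x - zeta x0) <=
               Rabs (zeta x - zeta x0 - L * (x - x0)) + Rabs L * X).
  { unfold X; rewrite <- Rabs_mult.
    replace (zeta x - zeta x0) with (zeta x - zeta x0 - L * (x - x0) + L * (x - x0)) at 1 by ring.
    apply Rabs_triang. }
  assert (Hmax : Rmax (Rabs (zeta x - zeta x0)) (Rabs (tau x - tau x0)) <=
                 Rabs (zeta x - zeta x0 - L * (x - x0)) + (Rabs L + 1) * X).
  { pose proof (Rabs_pos (zeta x - zeta x0 - L * (x - x0))).
    pose proof (Rabs_pos L).
    apply Rmax_lub; nra. }
  set (D := Rabs (zeta x - zeta x0 - L * (x - x0))) in *.
  assert (HD0 : 0 <= D) by apply Rabs_pos.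
  assert (HD : Rabs p * D <= e * (D + (Rabs L + 1) * X)).
  { eapply Rle_trans; [exact H1|]; apply Rmult_le_compat_l; lra. }
  assert (HD2 : D <= eps / 2 * X).
  { apply Rmult_le_reg_l with (Rabs p / 2); [lra|].
    assert (e * D <= Rabs p / 2 * D) by (apply Rmult_le_compat_r; lra).
    assert (e * (4 * (Rabs L + 1)) * X <= eps * Rabs p * X) by (apply Rmult_le_compat_r; lra).
    lra. }
  replace ((zeta x - zeta x0) / (x - x0) - L)
    with ((zeta x - zeta x0 - L * (x - x0)) / (x - x0)) by (field; lra).
  rewrite Rabs_div by lra; fold D X.
  apply Rle_lt_trans with (eps / 2); [|lra].
  apply Rle_div_l; [exact Hx0|exact HD2].
Qed.

Lemma continuous_of_2d (f : R -> R -> R) (g k : R -> R) (x : R) :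
  continuity_2d_pt f (g x) (k x) -> continuous g x -> continuous k x ->
  continuous (fun y => f (g y) (k y)) x.
Proof.
  intros Hf Hg Hk.
  apply (continuous_comp_2 g k f); auto.
  now apply (continuity_2d_pt_filterlim f).
Qed.

Lemma abs_le_at_right (Q : R -> R) (C d : R) :
  continuous Q 0 -> 0 < d -> (forall x, 0 < x < d -> Rabs (Q x) <= C) -> Rabs (Q 0) <= C.
Proof.
  intros HQ Hd H; apply Rnot_lt_le; intros Hlt.
  destruct (proj1 (filterlim_locally _ _) HQ (mkposreal (Rabs (Q 0) - C) ltac:(lra)))
    as [[e He] Hb].
  pose proof (Rmin_pos d e Hd He); pose proof (Rmin_l d e); pose proof (Rmin_r d e).
  specialize (H (Rmin d e / 2) ltac:(lra)).
  assert (Hq : Rabs (Q (Rmin d e / 2) - Q 0) < Rabs (Q 0) - C).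
  { apply (Hb (Rmin d e / 2)); change (Rabs (Rmin d e / 2 - 0) < e).
    rewrite Rminus_0_r, Rabs_right; lra. }
  pose proof (Rabs_triang_inv (Q 0) (Q (Rmin d e / 2))).
  rewrite <- Rabs_Ropp, Ropp_minus_distr in Hq; lra.
Qed.

(* The functions are continuous beyond the moving domain: see [ext]. *)
Record c1_up_to_boundary (s : R -> R) (f fz ft : R -> R -> R) : Prop := {
  c1_cont : forall z t, 0 < t -> continuity_2d_pt f z t;
  c1_cont_z : forall z t, 0 < t -> continuity_2d_pt fz z t;
  c1_cont_t : forall z t, 0 < t -> continuity_2d_pt ft z t;
  c1_z : forall z t, open_dom zero_bd s (z, t) -> is_derive (fun x => f x t) z (fz z t);
  c1_t : forall z t, open_dom zero_bd s (z, t) -> is_derive (fun tau => f z tau) t (ft z t)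
}.

Lemma continuous_abs_lt (f : R -> R) (x e : R) :
  continuous f x -> 0 < e -> exists d, 0 < d /\ forall y, Rabs (y - x) < d -> Rabs (f y - f x) < e.
Proof.
  intros Hf He.
  destruct (proj1 (filterlim_locally _ _) Hf (mkposreal e He)) as [[d Hd] H].
  exists d; split; [exact Hd|exact H].
Qed.

Lemma locally_2d_open_dom (s : R -> R) (z t : R) :
  (forall tau, 0 < tau -> continuous s tau) ->
  open_dom zero_bd s (z, t) -> locally_2d (fun a b => open_dom zero_bd s (a, b)) z t.
Proof.
  intros Hs [Ht [Hz1 Hz2]]; simpl in *; unfold zero_bd in *.
  destruct (continuous_abs_lt s t ((s t - z) / 2)) as [d [Hd H]]; [now apply Hs|lra|].
  assert (He : 0 < Rmin (Rmin d t) (Rmin z ((s t - z) / 2))).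
  { repeat apply Rmin_pos; lra. }
  exists (mkposreal _ He); simpl; intros a b Ha Hb.
  pose proof (Rmin_l (Rmin d t) (Rmin z ((s t - z) / 2))).
  pose proof (Rmin_r (Rmin d t) (Rmin z ((s t - z) / 2))).
  pose proof (Rmin_l d t); pose proof (Rmin_r d t).
  pose proof (Rmin_l z ((s t - z) / 2)); pose proof (Rmin_r z ((s t - z) / 2)).
  specialize (H b ltac:(lra)).
  apply Rabs_def2 in Ha; apply Rabs_def2 in Hb; apply Rabs_def2 in H.
  unfold open_dom, zero_bd; simpl; lra.
Qed.

(* Differentiate along the shifted curve [c + e * delta], which stays in the open
   domain, and let [delta] tend to [0] in the mean value theorem. *)
Lemma boundary_derive (s : R -> R) (f fz ft : R -> R -> R) (c dc : R -> R) (e t0 : R) :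
  (forall tau, 0 < tau -> continuous s tau) ->
  c1_up_to_boundary s f fz ft ->
  (forall t, 0 < t -> is_derive c t (dc t)) -> continuous dc t0 ->
  0 < t0 -> Rabs e <= 1 ->
  (exists d, 0 < d /\ forall t delta, Rabs (t - t0) < d -> 0 < delta < d ->
     0 < c t + e * delta < s t) ->
  is_derive (fun t => f (c t) t) t0 (fz (c t0) t0 * dc t0 + ft (c t0) t0).
Proof.
  intros Hs Hf Hc Hdc Ht0 He [d [Hd Hin]].
  assert (Hcc : forall t, 0 < t -> continuous c t).
  { intros t Ht; apply (ex_derive_continuous c); exists (dc t); auto. }
  set (G := fun z t => fz z t * dc t + ft z t).
  assert (HG : continuity_2d_pt G (c t0) t0).
  { apply continuity_2d_pt_plus; [apply continuity_2d_pt_mult|].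
    - now apply (c1_cont_z _ _ _ _ Hf).
    - apply (continuity_1d_2d_pt_comp dc (fun _ t => t)).
      + now apply continuity_pt_filterlim.
      + apply continuity_2d_pt_id2.
    - now apply (c1_cont_t _ _ _ _ Hf). }
  change (fz (c t0) t0 * dc t0 + ft (c t0) t0) with (G (c t0) t0).
  apply is_derive_eps; intros eps Heps.
  destruct (proj1 (continuity_2d_eps _ _ _) HG (eps / 2)) as [d1 [Hd1 HG1]]; [lra|].
  destruct (continuous_abs_lt c t0 (d1 / 2)) as [d2 [Hd2 Hc2]]; [auto|lra|].
  (* Half of [d1] is spent on the motion of [c], the other half on the shift [e * delta]; [r <= t0]
     keeps all times positive. *)
  set (r := Rmin (Rmin d (d1 / 2)) (Rmin d2 t0)).
  assert (Hr : 0 < r) by (repeat apply Rmin_pos; lra).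
  assert (Hrs : r <= d /\ r <= d1 / 2 /\ r <= d2 /\ r <= t0).
  { unfold r; pose proof (Rmin_l (Rmin d (d1 / 2)) (Rmin d2 t0)).
    pose proof (Rmin_r (Rmin d (d1 / 2)) (Rmin d2 t0)).
    pose proof (Rmin_l d (d1 / 2)); pose proof (Rmin_r d (d1 / 2)).
    pose proof (Rmin_l d2 t0); pose proof (Rmin_r d2 t0); lra. }
  clearbody r.
  exists r; split; [exact Hr|]; intros y Hy Hyr.
  assert (Hyt : 0 < y) by (apply Rabs_def2 in Hyr; lra).
  set (Q := fun delta => (f (c y + e * delta) y - f (c t0 + e * delta) t0) / (y - t0)
                         - G (c t0) t0).
  enough (HQ : Rabs (Q 0) <= eps / 2).
  { unfold Q in HQ; rewrite Rmult_0_r, !Rplus_0_r in HQ; lra. }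
  assert (Hsh : forall t, 0 < t -> continuous (fun delta => f (c t + e * delta) t) 0).
  { intros t Ht; apply (continuous_of_2d f (fun delta => c t + e * delta) (fun _ => t)).
    - now apply (c1_cont _ _ _ _ Hf).
    - apply (ex_derive_continuous (fun delta => c t + e * delta)); auto_derive; exact I.
    - apply continuous_const. }
  apply (abs_le_at_right Q _ r); [|exact Hr|].
  - unfold Q.
    apply (continuous_minus (fun delta =>
      (f (c y + e * delta) y - f (c t0 + e * delta) t0) / (y - t0)));
      [|apply continuous_const].
    apply (continuous_mult (fun delta => f (c y + e * delta) y - f (c t0 + e * delta) t0)
      (fun _ => / (y - t0))); [|apply continuous_const].
    apply (continuous_minus (fun delta => f (c y + e * delta) y)); now apply Hsh.
  - intros delta Hdelta.
    destruct (MVT_cor4 (fun t => f (c t + e * delta) t) (fun t => G (c t + e * delta) t)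
      t0 (Rabs (y - t0))) with (b := y) as [t [Ht1 Ht2]]; [|lra|].
    + intros t Ht.
      assert (Htr : Rabs (t - t0) < r) by lra.
      assert (Htp : 0 < t) by (apply Rabs_def2 in Htr; lra).
      assert (HD : open_dom zero_bd s (c t + e * delta, t)).
      { split; simpl; [exact Htp|]; apply Hin; lra. }
      unfold G.
      apply (chain_rule_curve f fz (fun t => c t + e * delta)).
      * eapply locally_2d_impl; [|apply (locally_2d_open_dom s _ _ Hs HD)].
        apply locally_2d_forall; intros a b Hab; now apply (c1_z _ _ _ _ Hf).
      * now apply (c1_cont_z _ _ _ _ Hf).
      * now apply (c1_t _ _ _ _ Hf).
      * rewrite <- (Rplus_0_r (dc t)); apply is_derive_Rplus; [now apply Hc|].
        apply (is_derive_const (e * delta) t).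
    + unfold Q; rewrite Ht1.
      replace (G (c t + e * delta) t * (y - t0) / (y - t0)) with (G (c t + e * delta) t)
        by (field; lra).
      left; apply HG1; [|lra].
      specialize (Hc2 t ltac:(lra)).
      replace (c t + e * delta - c t0) with ((c t - c t0) + e * delta) by ring.
      eapply Rle_lt_trans; [apply Rabs_triang|].
      rewrite Rabs_mult, (Rabs_right delta) by lra.
      nra.
Qed.

(** * Constant extension across the lateral boundaries, and integrals from time 0 *)

Definition clamp (b z : R) : R := Rmax 0 (Rmin z b).

(** Continuity on the closed moving domain becomes continuity at every [(z, t)] with [t > 0];
    derivatives are transferred at interior points only. *)
Definition ext (s : R -> R) (f : R -> R -> R) (z t : R) : R := f (clamp (s t) z) t.

Lemma clamp_id (b z : R) : 0 <= z <= b -> clamp b z = z.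
Proof. intros H; unfold clamp; rewrite Rmin_left, Rmax_right; lra. Qed.

Lemma clamp_in (b z : R) : 0 < b -> 0 <= clamp b z <= b.
Proof.
  intros Hb; unfold clamp; split; [apply Rmax_l|].
  apply Rmax_lub; [lra|apply Rmin_r].
Qed.

(** The two increments add up to [z' - z], so for [z < z'] at least one is positive; this gives the
    strict monotonicity of [hYe]. *)
Lemma clamp_mono (b z z' : R) : z <= z' ->
  clamp b z <= clamp b z' /\ z - clamp b z <= z' - clamp b z'.
Proof.
  intros H; unfold clamp, Rmax, Rmin.
  repeat (destruct Rle_dec; try lra).
Qed.

Lemma clamp_lipschitz (b b' z z' : R) :
  Rabs (clamp b' z' - clamp b z) <= Rabs (z' - z) + Rabs (b' - b).
Proof.
  unfold clamp, Rmax, Rmin.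
  pose proof (Rle_abs (z' - z)); pose proof (Rle_abs (- (z' - z))).
  pose proof (Rle_abs (b' - b)); pose proof (Rle_abs (- (b' - b))).
  rewrite Rabs_Ropp in *.
  repeat destruct Rle_dec; apply Rabs_le; lra.
Qed.

Lemma continuity_2d_pt_clamp (s : R -> R) (z t : R) :
  continuous s t -> continuity_2d_pt (fun z t => clamp (s t) z) z t.
Proof.
  intros Hs; apply continuity_2d_eps; intros e He.
  destruct (continuous_abs_lt s t (e / 2) Hs) as [d [Hd H]]; [lra|].
  exists (Rmin d (e / 2)); split; [apply Rmin_pos; lra|]; intros a b Ha Hb.
  pose proof (Rmin_l d (e / 2)); pose proof (Rmin_r d (e / 2)).
  specialize (H b ltac:(lra)).
  pose proof (clamp_lipschitz (s t) (s b) z a); lra.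
Qed.

Lemma continuity_2d_pt_clamped (s : R -> R) (f : R -> R -> R) :
  (forall t, 0 < t -> continuous s t /\ 0 < s t) ->
  cont2_on (closed_dom zero_bd s) f ->
  forall z t, 0 < t -> continuity_2d_pt (ext s f) z t.
Proof.
  intros Hs Hf z t Ht.
  assert (Hcl : forall z t, 0 < t -> closed_dom zero_bd s (clamp (s t) z, t)).
  { intros z' t' Ht'; split; [exact Ht'|]; simpl; unfold zero_bd.
    now apply clamp_in, Hs. }
  apply continuity_2d_eps; intros e He.
  destruct (proj1 (filterlim_locally _ _) (Hf _ (Hcl z t Ht)) (mkposreal e He))
    as [[d Hd] H]; simpl in H.
  destruct (proj1 (continuity_2d_eps _ _ _)
    (continuity_2d_pt_clamp s z t (proj1 (Hs t Ht))) d Hd) as [d' [Hd' Hcd]].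
  exists (Rmin (Rmin d' d) t); split; [repeat apply Rmin_pos; assumption|].
  intros a b Ha Hb.
  pose proof (Rmin_l (Rmin d' d) t); pose proof (Rmin_r (Rmin d' d) t).
  pose proof (Rmin_l d' d); pose proof (Rmin_r d' d).
  assert (Hb0 : 0 < b) by (apply Rabs_def2 in Hb; lra).
  apply (H (clamp (s b) a, b)); [|now apply Hcl].
  split; simpl.
  - apply (Hcd a b); lra.
  - change (Rabs (b - t) < d); lra.
Qed.

Lemma ext_on_closed (s : R -> R) (f : R -> R -> R) (z t : R) :
  closed_dom zero_bd s (z, t) -> ext s f z t = f z t.
Proof. intros [_ H]; unfold ext; now rewrite clamp_id. Qed.

Lemma open_dom_closed (a b : R -> R) (p : R * R) : open_dom a b p -> closed_dom a b p.
Proof. unfold open_dom, closed_dom; lra. Qed.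

Lemma locally_2d_open_dom_1 (s : R -> R) (z t : R) :
  (forall tau, 0 < tau -> continuous s tau) -> open_dom zero_bd s (z, t) ->
  locally z (fun a => open_dom zero_bd s (a, t)) /\
  locally t (fun b => open_dom zero_bd s (z, b)).
Proof.
  intros Hs H; apply (locally_2d_open_dom s z t Hs) in H; split.
  - apply (locally_2d_1d_const_y _ z t H).
  - apply (locally_2d_1d_const_x _ z t H).
Qed.

Lemma is_derive_ext_z (s : R -> R) (f : R -> R -> R) (z t l : R) :
  (forall tau, 0 < tau -> continuous s tau) -> open_dom zero_bd s (z, t) ->
  is_derive (fun x => f x t) z l -> is_derive (fun x => ext s f x t) z l.
Proof.
  intros Hs HD; apply is_derive_ext_loc.
  eapply filter_imp; [|apply (proj1 (locally_2d_open_dom_1 s z t Hs HD))].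
  intros a Ha; symmetry; now apply ext_on_closed, open_dom_closed.
Qed.

Lemma is_derive_ext_t (s : R -> R) (f : R -> R -> R) (z t l : R) :
  (forall tau, 0 < tau -> continuous s tau) -> open_dom zero_bd s (z, t) ->
  is_derive (fun tau => f z tau) t l -> is_derive (fun tau => ext s f z tau) t l.
Proof.
  intros Hs HD; apply is_derive_ext_loc.
  eapply filter_imp; [|apply (proj2 (locally_2d_open_dom_1 s z t Hs HD))].
  intros a Ha; symmetry; now apply ext_on_closed, open_dom_closed.
Qed.

(** The value of [F] at 0 is replaced by its right limit [l]. Here [f] is the derivative in a form
    whose continuity is visible, and [g] the integrand as it occurs in the equations. *)
Lemma is_int_from_0_derive (F f g : R -> R) (l t : R) :
  (forall x, 0 < x -> is_derive F x (f x)) -> (forall x, 0 < x -> continuous f x) ->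
  (forall x, 0 < x -> f x = g x) ->
  filterlim F (at_right 0) (locally l) -> 0 < t -> is_int_from_0 g t (F t - l).
Proof.
  intros HF Hf Hg Hl Ht; unfold is_int_from_0.
  assert (Hpos : filter_prod (at_right 0) (at_point t)
    (fun ab : R * R => forall x, Rmin (fst ab) (snd ab) <= x <= Rmax (fst ab) (snd ab) -> 0 < x)).
  { exists (fun a => 0 < a) (fun b => b = t).
    - exists (mkposreal 1 Rlt_0_1); intros a _ Ha; exact Ha.
    - reflexivity.
    - simpl; intros a b Ha -> x Hx.
      pose proof (Rmin_pos a t Ha Ht); lra. }
  apply (is_RInt_gen_ext (Derive F)).
  { eapply filter_imp; [|exact Hpos]; intros ab H x Hx.
    assert (Hx0 : 0 < x) by (apply H; lra).
    rewrite <- Hg by exact Hx0; now apply is_derive_unique, HF. }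
  apply is_RInt_gen_Derive; auto.
  - eapply filter_imp; [|exact Hpos]; intros ab H x Hx; exists (f x); auto.
  - eapply filter_imp; [|exact Hpos]; intros ab H x Hx.
    specialize (H x Hx).
    apply (continuous_ext_loc (Derive F) f).
    + exists (mkposreal x H); intros y Hy; change (Rabs (y - x) < x) in Hy.
      apply Rabs_def2 in Hy; symmetry; apply is_derive_unique, HF; lra.
    + now apply Hf.
  - intros P HP; unfold filtermap, at_point; now apply locally_singleton.
Qed.

(** * The hodograph transformation of the Burgers equation *)

(** [bg_t] is the Burgers equation and its [z]-derivative. The sign of [u1] makes [y] increasing,
    because [y_z = - (2 / sigma) * u1 / E]. [bg_clamp] records that [u] is a constant continuation
    outside the domain. *)
Record burgers (s : R -> R) (u u1 u2 u3 : R -> R -> R) : Prop := {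
  bg_s : forall t, 0 < t -> continuous s t /\ 0 < s t;
  bg_clamp : forall z t, u (clamp (s t) z) t = u z t;
  bg_neg : forall z t, 0 < t -> u z t <= 0 /\ u1 z t < 0;
  bg_cont : forall z t, 0 < t -> continuity_2d_pt u z t /\ continuity_2d_pt u1 z t /\
    continuity_2d_pt u2 z t;
  bg_z : forall z t, open_dom zero_bd s (z, t) ->
    is_derive (fun x => u x t) z (u1 z t) /\ is_derive (fun x => u1 x t) z (u2 z t) /\
    is_derive (fun x => u2 x t) z (u3 z t);
  bg_t : forall z t, open_dom zero_bd s (z, t) ->
    is_derive (fun tau => u z tau) t (u2 z t + 2 * u z t * u1 z t) /\
    is_derive (fun tau => u1 z tau) t (u3 z t + 2 * u1 z t ^ 2 + 2 * u z t * u2 z t)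
}.

(* With [u = w_z / w], [hE = exp (m y)], [hY = y] and [hTheta = theta], all as
   functions of the parameter [z] and of [t]. *)
Definition hE (sigma m : R) (u : R -> R -> R) (z t : R) : R := 1 - 2 * m / sigma * u z t.

Definition hY (sigma m : R) (u : R -> R -> R) (z t : R) : R :=
  1 / m * ln (hE sigma m u z t).

Definition hTheta (sigma m : R) (u u1 : R -> R -> R) (z t : R) : R :=
  - (sigma / 2) * hE sigma m u z t / u1 z t.

Definition hTheta_z (sigma m : R) (u u1 u2 : R -> R -> R) (z t : R) : R :=
  m + sigma / 2 * hE sigma m u z t * u2 z t / u1 z t ^ 2.

(* Strictly increasing and onto for fixed [t], so that its inverse is defined and
   continuous beyond the strip [Y0 <= y <= Y1]. *)
Definition hYe (sigma m : R) (s : R -> R) (u : R -> R -> R) (z t : R) : R :=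
  hY sigma m u z t + (z - clamp (s t) z).

Lemma hE_pos (sigma m : R) s u u1 u2 u3 (z t : R) :
  0 < sigma -> 0 < m -> burgers s u u1 u2 u3 -> 0 < t -> 1 <= hE sigma m u z t.
Proof.
  intros Hsg Hm HB Ht; destruct (bg_neg _ _ _ _ _ HB z t Ht) as [Hu _].
  unfold hE.
  assert (0 < 2 * m / sigma) by (apply Rdiv_lt_0_compat; lra).
  nra.
Qed.

Lemma hY_z (sigma m : R) s u u1 u2 u3 (z t : R) :
  0 < sigma -> 0 < m -> burgers s u u1 u2 u3 -> open_dom zero_bd s (z, t) ->
  is_derive (fun x => hY sigma m u x t) z (/ hTheta sigma m u u1 z t).
Proof.
  intros Hsg Hm HB HD.
  pose proof (hE_pos sigma m s u u1 u2 u3 z t Hsg Hm HB (proj1 HD)) as HE.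
  destruct (bg_neg _ _ _ _ _ HB z t (proj1 HD)) as [_ Hu1].
  destruct (bg_z _ _ _ _ _ HB z t HD) as [H0 _].
  unfold hTheta, hY; unfold hE in *.
  auto_derive.
  - repeat split; try (eexists; eassumption); lra.
  - rewrite (is_derive_unique (fun x : R => u x t) z _ H0).
    field; repeat split; try lra.
    (* Clearing denominators leaves the side condition [sigma - 2 * m * u <> 0], which is
       [sigma * E <> 0]. *)
    intros Hc; assert (0 < sigma * (1 - 2 * m / sigma * u z t)) by (apply Rmult_lt_0_compat; lra).
    assert (sigma * (1 - 2 * m / sigma * u z t) = sigma - 2 * m * u z t) by (field; lra).
    lra.
Qed.

Lemma hY_t (sigma m : R) s u u1 u2 u3 (z t : R) :
  0 < sigma -> 0 < m -> burgers s u u1 u2 u3 -> open_dom zero_bd s (z, t) ->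
  is_derive (fun tau => hY sigma m u z tau) t
    (- (2 / sigma) * (u2 z t + 2 * u z t * u1 z t) / hE sigma m u z t).
Proof.
  intros Hsg Hm HB HD.
  pose proof (hE_pos sigma m s u u1 u2 u3 z t Hsg Hm HB (proj1 HD)) as HE.
  destruct (bg_t _ _ _ _ _ HB z t HD) as [H0 _].
  unfold hY; unfold hE in *.
  auto_derive.
  - repeat split; try (eexists; eassumption); lra.
  - rewrite (is_derive_unique (fun x : R => u z x) t _ H0).
    field; repeat split; try lra.
    intros Hc; assert (0 < sigma * (1 - 2 * m / sigma * u z t)) by (apply Rmult_lt_0_compat; lra).
    assert (sigma * (1 - 2 * m / sigma * u z t) = sigma - 2 * m * u z t) by (field; lra).
    lra.
Qed.

Lemma hTheta_pos (sigma m : R) s u u1 u2 u3 (z t : R) :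
  0 < sigma -> 0 < m -> burgers s u u1 u2 u3 -> 0 < t -> 0 < hTheta sigma m u u1 z t.
Proof.
  intros Hsg Hm HB Ht.
  pose proof (hE_pos sigma m s u u1 u2 u3 z t Hsg Hm HB Ht) as HE.
  destruct (bg_neg _ _ _ _ _ HB z t Ht) as [_ Hu1].
  unfold hTheta.
  replace (- (sigma / 2) * hE sigma m u z t / u1 z t)
    with (sigma / 2 * hE sigma m u z t / - u1 z t) by (field; lra).
  apply Rdiv_lt_0_compat; [apply Rmult_lt_0_compat|]; lra.
Qed.

Lemma continuity_2d_hE (sigma m : R) s u u1 u2 u3 (z t : R) :
  burgers s u u1 u2 u3 -> 0 < t -> continuity_2d_pt (hE sigma m u) z t.
Proof.
  intros HB Ht; apply continuity_2d_pt_minus; [apply continuity_2d_pt_const|].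
  apply continuity_2d_pt_mult; [apply continuity_2d_pt_const|].
  now apply (bg_cont _ _ _ _ _ HB).
Qed.

Lemma continuity_2d_hY (sigma m : R) s u u1 u2 u3 (z t : R) :
  0 < sigma -> 0 < m -> burgers s u u1 u2 u3 -> 0 < t ->
  continuity_2d_pt (hY sigma m u) z t.
Proof.
  intros Hsg Hm HB Ht; apply continuity_2d_pt_mult; [apply continuity_2d_pt_const|].
  apply (continuity_1d_2d_pt_comp ln (hE sigma m u)).
  - apply continuity_pt_filterlim, (ex_derive_continuous ln).
    exists (/ hE sigma m u z t); apply is_derive_ln.
    pose proof (hE_pos sigma m s u u1 u2 u3 z t Hsg Hm HB Ht); lra.
  - now apply (continuity_2d_hE sigma m s u u1 u2 u3).
Qed.

Lemma continuity_2d_hTheta (sigma m : R) s u u1 u2 u3 (z t : R) :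
  burgers s u u1 u2 u3 -> 0 < t -> continuity_2d_pt (hTheta sigma m u u1) z t.
Proof.
  intros HB Ht.
  destruct (bg_neg _ _ _ _ _ HB z t Ht) as [_ Hu1].
  apply continuity_2d_pt_mult; [apply continuity_2d_pt_mult|].
  - apply continuity_2d_pt_const.
  - now apply (continuity_2d_hE sigma m s u u1 u2 u3).
  - apply continuity_2d_pt_inv; [now apply (bg_cont _ _ _ _ _ HB)|lra].
Qed.

Lemma continuity_2d_hTheta_z (sigma m : R) s u u1 u2 u3 (z t : R) :
  burgers s u u1 u2 u3 -> 0 < t -> continuity_2d_pt (hTheta_z sigma m u u1 u2) z t.
Proof.
  intros HB Ht.
  destruct (bg_neg _ _ _ _ _ HB z t Ht) as [_ Hu1].
  destruct (bg_cont _ _ _ _ _ HB z t Ht) as (_ & Hc1 & Hc2).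
  apply continuity_2d_pt_plus; [apply continuity_2d_pt_const|].
  apply continuity_2d_pt_mult; [apply continuity_2d_pt_mult; [apply continuity_2d_pt_mult|]|].
  - apply continuity_2d_pt_const.
  - now apply (continuity_2d_hE sigma m s u u1 u2 u3).
  - exact Hc2.
  - apply (continuity_2d_pt_inv (fun a b => u1 a b ^ 2)); [|apply pow_nonzero; lra].
    apply (continuity_2d_pt_ext (fun a b => u1 a b * u1 a b)); [intros; ring|].
    now apply continuity_2d_pt_mult.
Qed.

Lemma continuity_2d_hYe (sigma m : R) s u u1 u2 u3 (z t : R) :
  0 < sigma -> 0 < m -> burgers s u u1 u2 u3 -> 0 < t ->
  continuity_2d_pt (hYe sigma m s u) z t.
Proof.
  intros Hsg Hm HB Ht; apply continuity_2d_pt_plus.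
  - now apply (continuity_2d_hY sigma m s u u1 u2 u3).
  - apply continuity_2d_pt_minus; [apply continuity_2d_pt_id1|].
    now apply continuity_2d_pt_clamp, (bg_s _ _ _ _ _ HB).
Qed.

Lemma continuous_slice (f : R -> R -> R) (z t : R) :
  continuity_2d_pt f z t -> continuous (fun x => f x t) z.
Proof.
  intros H; apply (continuous_of_2d f (fun x => x) (fun _ => t)); auto.
  - apply continuous_id.
  - apply continuous_const.
Qed.

(** Inside, the slope is [/ hTheta > 0]; outside, [hY] is constant and the added term has slope 1.
    [clamp_mono] treats intervals that cross a boundary. *)
Lemma hYe_increasing (sigma m : R) s u u1 u2 u3 (z z' t : R) :
  0 < sigma -> 0 < m -> burgers s u u1 u2 u3 -> 0 < t -> z < z' ->
  hYe sigma m s u z t < hYe sigma m s u z' t.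
Proof.
  intros Hsg Hm HB Ht Hz.
  assert (Hin : forall a b, 0 <= a <= s t -> 0 <= b <= s t -> a < b ->
             hY sigma m u a t < hY sigma m u b t).
  { intros a b Ha Hb Hab.
    destruct (MVT_gen (fun x => hY sigma m u x t) a b (fun x => / hTheta sigma m u u1 x t))
      as [c [Hc1 Hc2]].
    - rewrite Rmin_left, Rmax_right by lra; intros x Hx.
      apply (hY_z sigma m s u u1 u2 u3); auto.
      split; unfold zero_bd; simpl; lra.
    - intros x _; apply continuity_pt_filterlim.
      apply (continuous_slice (hY sigma m u)).
      now apply (continuity_2d_hY sigma m s u u1 u2 u3).
    - pose proof (hTheta_pos sigma m s u u1 u2 u3 c t Hsg Hm HB Ht) as Hp.
      apply Rinv_0_lt_compat in Hp.
      assert (0 < / hTheta sigma m u u1 c t * (b - a)) by (apply Rmult_lt_0_compat; lra).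
      lra. }
  assert (Hcl : forall x, hY sigma m u x t = hY sigma m u (clamp (s t) x) t).
  { intros x; unfold hY, hE; now rewrite (bg_clamp _ _ _ _ _ HB). }
  destruct (bg_s _ _ _ _ _ HB t Ht) as [_ Hs].
  destruct (clamp_mono (s t) z z') as [H1 H2]; [lra|].
  unfold hYe; rewrite (Hcl z), (Hcl z').
  destruct H1 as [H1|H1].
  - pose proof (Hin _ _ (clamp_in (s t) z Hs) (clamp_in (s t) z' Hs) H1); lra.
  - rewrite H1 in *; lra.
Qed.

Lemma hYe_onto (sigma m : R) s u u1 u2 u3 (y t : R) :
  0 < sigma -> 0 < m -> burgers s u u1 u2 u3 -> 0 < t ->
  exists z, hYe sigma m s u z t = y.
Proof.
  intros Hsg Hm HB Ht.
  destruct (bg_s _ _ _ _ _ HB t Ht) as [_ Hs].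
  set (F := fun z => hYe sigma m s u z t).
  (* Outside [[0, s t]] the function [F] has slope 1, so a step of length [N] beyond either end
     passes the level [y]. *)
  set (N := Rabs y + Rabs (F 0) + Rabs (F (s t))).
  assert (HN : 0 <= N /\ y - F 0 <= N /\ F 0 - y <= N /\ y - F (s t) <= N).
  { unfold N.
    pose proof (Rle_abs y); pose proof (Rle_abs (- y)).
    pose proof (Rle_abs (F 0)); pose proof (Rle_abs (- F 0)); pose proof (Rle_abs (- F (s t))).
    pose proof (Rabs_pos (F (s t))).
    rewrite Rabs_Ropp in *; lra. }
  assert (E0 : F (- N) = F 0 - N).
  { unfold F, hYe.
    unfold hY, hE; rewrite <- (bg_clamp _ _ _ _ _ HB (- N) t).
    replace (clamp (s t) (- N)) with 0; [rewrite clamp_id by lra; ring|].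
    unfold clamp; rewrite Rmin_left, Rmax_left; lra. }
  assert (E1 : F (s t + N) = F (s t) + N).
  { unfold F, hYe, hY, hE; rewrite <- (bg_clamp _ _ _ _ _ HB (s t + N) t).
    replace (clamp (s t) (s t + N)) with (s t); [rewrite clamp_id by lra; ring|].
    unfold clamp; rewrite Rmin_right, Rmax_right; lra. }
  destruct (IVT_gen F (- N) (s t + N) y) as [z [_ Hz]].
  - intros z; apply continuity_pt_filterlim, (continuous_slice (hYe sigma m s u)).
    now apply (continuity_2d_hYe sigma m s u u1 u2 u3).
  - rewrite E0, E1, Rmin_left, Rmax_right; try lra.
  - now exists z.
Qed.

(** Continuity of the inverse: at [Z y t - e] and [Z y t + e] the values of [hYe] lie strictly on
    the two sides of [y]. This persists for nearby [(y', t')], and monotonicity at time [t'] traps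
    [Z y' t'] between these points. *)
Lemma hodograph_inverse (sigma m : R) s u u1 u2 u3 :
  0 < sigma -> 0 < m -> burgers s u u1 u2 u3 ->
  exists Z : R -> R -> R,
    (forall y t, 0 < t -> hYe sigma m s u (Z y t) t = y) /\
    (forall y t, 0 < t -> continuity_2d_pt Z y t).
Proof.
  intros Hsg Hm HB.
  set (Z := fun y t => epsilon (inhabits 0) (fun z => hYe sigma m s u z t = y)).
  assert (HZ : forall y t, 0 < t -> hYe sigma m s u (Z y t) t = y).
  { intros y t Ht; unfold Z; apply epsilon_spec.
    now apply (hYe_onto sigma m s u u1 u2 u3). }
  exists Z; split; [exact HZ|]; intros y t Ht.
  apply continuity_2d_eps; intros e He.
  assert (Hc := fun z => continuity_2d_hYe sigma m s u u1 u2 u3 z t Hsg Hm HB Ht).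
  pose proof (hYe_increasing sigma m s u u1 u2 u3 (Z y t - e) (Z y t) t Hsg Hm HB Ht
    ltac:(lra)) as Hl.
  pose proof (hYe_increasing sigma m s u u1 u2 u3 (Z y t) (Z y t + e) t Hsg Hm HB Ht
    ltac:(lra)) as Hr.
  rewrite (HZ y t Ht) in Hl, Hr.
  (* Each gap is shared equally between the change of [y] and the change of [hYe] with time. *)
  set (gl := y - hYe sigma m s u (Z y t - e) t).
  set (gr := hYe sigma m s u (Z y t + e) t - y).
  destruct (proj1 (continuity_2d_eps _ _ _) (Hc (Z y t - e)) (gl / 2)) as [d1 [Hd1 H1]];
    [unfold gl; lra|].
  destruct (proj1 (continuity_2d_eps _ _ _) (Hc (Z y t + e)) (gr / 2)) as [d2 [Hd2 H2]];
    [unfold gr; lra|].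
  set (r := Rmin (Rmin d1 d2) (Rmin t (Rmin (gl / 2) (gr / 2)))).
  assert (Hr0 : 0 < r) by (repeat apply Rmin_pos; unfold gl, gr; lra).
  assert (Hrs : r <= d1 /\ r <= d2 /\ r <= t /\ r <= gl / 2 /\ r <= gr / 2).
  { unfold r.
    pose proof (Rmin_l (Rmin d1 d2) (Rmin t (Rmin (gl / 2) (gr / 2)))).
    pose proof (Rmin_r (Rmin d1 d2) (Rmin t (Rmin (gl / 2) (gr / 2)))).
    pose proof (Rmin_l d1 d2); pose proof (Rmin_r d1 d2).
    pose proof (Rmin_l t (Rmin (gl / 2) (gr / 2))); pose proof (Rmin_r t (Rmin (gl / 2) (gr / 2))).
    pose proof (Rmin_l (gl / 2) (gr / 2)); pose proof (Rmin_r (gl / 2) (gr / 2)); lra. }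
  clearbody r.
  exists r; split; [exact Hr0|]; intros y' t' Hy' Ht'.
  assert (Ht0 : 0 < t') by (apply Rabs_def2 in Ht'; lra).
  specialize (H1 (Z y t - e) t'); specialize (H2 (Z y t + e) t').
  rewrite Rminus_diag, Rabs_R0 in H1, H2.
  specialize (H1 ltac:(lra) ltac:(lra)); specialize (H2 ltac:(lra) ltac:(lra)).
  apply Rabs_def2 in H1; apply Rabs_def2 in H2; apply Rabs_def2 in Hy'.
  assert (Hmono : forall a b, hYe sigma m s u a t' < hYe sigma m s u b t' -> a < b).
  { intros a b Hab; apply Rnot_le_lt; intros [Hle|Hle].
    - pose proof (hYe_increasing sigma m s u u1 u2 u3 b a t' Hsg Hm HB Ht0 Hle); lra.
    - subst; lra. }
  apply Rabs_def1.
  - enough (Z y' t' < Z y t + e) by lra.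
    apply Hmono; rewrite (HZ y' t' Ht0); unfold gr in *; lra.
  - enough (Z y t - e < Z y' t') by lra.
    apply Hmono; rewrite (HZ y' t' Ht0); unfold gl in *; lra.
Qed.

Lemma hYe_closed (sigma m : R) s u (z t : R) :
  0 <= z <= s t -> hYe sigma m s u z t = hY sigma m u z t.
Proof. intros H; unfold hYe; rewrite clamp_id by exact H; ring. Qed.

Lemma hodograph_strip (sigma m : R) s u u1 u2 u3 (Z : R -> R -> R) (y t : R) :
  0 < sigma -> 0 < m -> burgers s u u1 u2 u3 ->
  (forall y t, 0 < t -> hYe sigma m s u (Z y t) t = y) -> 0 < t ->
  (hY sigma m u 0 t < y < hY sigma m u (s t) t <-> 0 < Z y t < s t) /\
  (hY sigma m u 0 t <= y <= hY sigma m u (s t) t <-> 0 <= Z y t <= s t).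
Proof.
  intros Hsg Hm HB HZ Ht.
  destruct (bg_s _ _ _ _ _ HB t Ht) as [_ Hs].
  rewrite <- (hYe_closed sigma m s u 0 t) by lra.
  rewrite <- (hYe_closed sigma m s u (s t) t) by lra.
  assert (Hinc := fun a b => hYe_increasing sigma m s u u1 u2 u3 a b t Hsg Hm HB Ht).
  specialize (HZ y t Ht).
  assert (Hlt : forall a b, hYe sigma m s u a t < hYe sigma m s u b t <-> a < b).
  { intros a b; split; [|apply Hinc].
    intros Hab; apply Rnot_le_lt; intros [Hle|Hle];
      [specialize (Hinc b a Hle)|rewrite Hle in Hab]; lra. }
  assert (Hle : forall a b, hYe sigma m s u a t <= hYe sigma m s u b t <-> a <= b).
  { intros a b; split; intros Hab; apply Rnot_lt_le; intros Hba;
      [apply (proj2 (Hlt b a)) in Hba|apply (proj1 (Hlt b a)) in Hba]; lra. }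
  revert HZ; generalize (Z y t); intros z <-.
  rewrite !Hlt, !Hle; tauto.
Qed.

Lemma hTheta_z_derive (sigma m : R) s u u1 u2 u3 (z t : R) :
  0 < sigma -> 0 < m -> burgers s u u1 u2 u3 -> open_dom zero_bd s (z, t) ->
  is_derive (fun x => hTheta sigma m u u1 x t) z (hTheta_z sigma m u u1 u2 z t).
Proof.
  intros Hsg Hm HB HD.
  destruct (bg_neg _ _ _ _ _ HB z t (proj1 HD)) as [_ Hu1].
  destruct (bg_z _ _ _ _ _ HB z t HD) as (H0 & H1 & _).
  unfold hTheta, hTheta_z, hE.
  auto_derive.
  - repeat split; try (eexists; eassumption); lra.
  - rewrite (is_derive_unique (fun x : R => u x t) z _ H0).
    rewrite (is_derive_unique (fun x : R => u1 x t) z _ H1).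
    field; lra.
Qed.

Lemma hTheta_t_derive (sigma m : R) s u u1 u2 u3 (z t : R) :
  0 < sigma -> 0 < m -> burgers s u u1 u2 u3 -> open_dom zero_bd s (z, t) ->
  is_derive (fun tau => hTheta sigma m u u1 z tau) t
    (m * (u2 z t + 2 * u z t * u1 z t) / u1 z t +
     sigma / 2 * hE sigma m u z t *
       (u3 z t + 2 * u1 z t ^ 2 + 2 * u z t * u2 z t) / u1 z t ^ 2).
Proof.
  intros Hsg Hm HB HD.
  destruct (bg_neg _ _ _ _ _ HB z t (proj1 HD)) as [_ Hu1].
  destruct (bg_t _ _ _ _ _ HB z t HD) as (H0 & H1).
  unfold hTheta, hE.
  auto_derive.
  - repeat split; try (eexists; eassumption); lra.
  - rewrite (is_derive_unique (fun x : R => u z x) t _ H0).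
    rewrite (is_derive_unique (fun x : R => u1 z x) t _ H1).
    field; lra.
Qed.

(** * Derivatives of the inverse and the equation for theta *)

Record hodograph_inv (sigma m : R) (s : R -> R) (u Z : R -> R -> R) : Prop := {
  hz_eq : forall y t, 0 < t -> hYe sigma m s u (Z y t) t = y;
  hz_cont : forall y t, 0 < t -> continuity_2d_pt Z y t
}.

Definition hstrip (sigma m : R) (s : R -> R) (u : R -> R -> R) : R * R -> Prop :=
  open_dom (fun t => hY sigma m u 0 t) (fun t => hY sigma m u (s t) t).

Lemma hstrip_Z (sigma m : R) s u u1 u2 u3 Z (y t : R) :
  0 < sigma -> 0 < m -> burgers s u u1 u2 u3 -> hodograph_inv sigma m s u Z ->
  hstrip sigma m s u (y, t) -> open_dom zero_bd s (Z y t, t).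
Proof.
  intros Hsg Hm HB HZ [Ht Hy]; split; [exact Ht|].
  apply (hodograph_strip sigma m s u u1 u2 u3); auto.
  apply (hz_eq _ _ _ _ _ HZ).
Qed.

Lemma bg_continuous s u u1 u2 u3 (t : R) : burgers s u u1 u2 u3 -> 0 < t -> continuous s t.
Proof. intros HB Ht; apply (bg_s _ _ _ _ _ HB t Ht). Qed.

Lemma hYe_z (sigma m : R) s u u1 u2 u3 (z t : R) :
  0 < sigma -> 0 < m -> burgers s u u1 u2 u3 -> open_dom zero_bd s (z, t) ->
  is_derive (fun x => hYe sigma m s u x t) z (/ hTheta sigma m u u1 z t).
Proof.
  intros Hsg Hm HB HD.
  apply (is_derive_ext_loc (fun x => hY sigma m u x t)).
  - eapply filter_imp;
      [|apply (proj1 (locally_2d_open_dom_1 s z t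
                (fun tau => bg_continuous s u u1 u2 u3 tau HB) HD))].
    intros a [_ Ha]; symmetry; apply hYe_closed; unfold zero_bd in Ha; simpl in Ha; lra.
  - now apply (hY_z sigma m s u u1 u2 u3).
Qed.

Lemma hYe_t (sigma m : R) s u u1 u2 u3 (z t : R) :
  0 < sigma -> 0 < m -> burgers s u u1 u2 u3 -> open_dom zero_bd s (z, t) ->
  is_derive (fun tau => hYe sigma m s u z tau) t
    (- (2 / sigma) * (u2 z t + 2 * u z t * u1 z t) / hE sigma m u z t).
Proof.
  intros Hsg Hm HB HD.
  apply (is_derive_ext_loc (fun tau => hY sigma m u z tau)).
  - eapply filter_imp;
      [|apply (proj2 (locally_2d_open_dom_1 s z t
                (fun tau => bg_continuous s u u1 u2 u3 tau HB) HD))].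
    intros a [_ Ha]; symmetry; apply hYe_closed; unfold zero_bd in Ha; simpl in Ha; lra.
  - now apply (hY_t sigma m s u u1 u2 u3).
Qed.

Lemma locally_2d_open_imp (s : R -> R) (P : R -> R -> Prop) (z t : R) :
  (forall tau, 0 < tau -> continuous s tau) ->
  (forall a b, open_dom zero_bd s (a, b) -> P a b) ->
  open_dom zero_bd s (z, t) -> locally_2d P z t.
Proof.
  intros Hs HP HD; eapply locally_2d_impl; [|apply (locally_2d_open_dom s z t Hs HD)].
  apply locally_2d_forall; exact HP.
Qed.

(** Implicit differentiation of [hYe (Z y t) t = y]: with [Y_z = / theta] it gives [Z_y = theta] and
    [Z_t = - Y_t * theta]. *)
Lemma hodograph_Z_derive (sigma m : R) s u u1 u2 u3 Z (y t : R) :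
  0 < sigma -> 0 < m -> burgers s u u1 u2 u3 -> hodograph_inv sigma m s u Z ->
  hstrip sigma m s u (y, t) ->
  is_derive (fun x => Z x t) y (hTheta sigma m u u1 (Z y t) t) /\
  is_derive (fun tau => Z y tau) t
    (- (- (2 / sigma) * (u2 (Z y t) t + 2 * u (Z y t) t * u1 (Z y t) t)
        / hE sigma m u (Z y t) t) * hTheta sigma m u u1 (Z y t) t).
Proof.
  intros Hsg Hm HB HZ HS.
  pose proof (hstrip_Z _ _ _ _ _ _ _ _ _ _ Hsg Hm HB HZ HS) as HD.
  pose proof (proj1 HD) as Ht; simpl in Ht.
  pose proof (hTheta_pos sigma m s u u1 u2 u3 (Z y t) t Hsg Hm HB Ht) as Hth.
  pose proof (Rinv_0_lt_compat _ Hth) as Hth'.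
  pose proof (hE_pos sigma m s u u1 u2 u3 (Z y t) t Hsg Hm HB Ht) as HE.
  (* Total differentiability comes from continuity of the [z]-derivative [/ hTheta] together with
     the mere existence of the [t]-derivative. *)
  assert (Hdiff := fun Hc => differentiable_of_partials (hYe sigma m s u)
    (fun a b => / hTheta sigma m u u1 a b) (Z y t) t _
    (locally_2d_open_imp s _ _ _ (fun tau => bg_continuous s u u1 u2 u3 tau HB)
      (fun a b => hYe_z sigma m s u u1 u2 u3 a b Hsg Hm HB) HD)
    Hc (hYe_t sigma m s u u1 u2 u3 (Z y t) t Hsg Hm HB HD)).
  assert (Hc : continuity_2d_pt (fun a b => / hTheta sigma m u u1 a b) (Z y t) t).
  { apply continuity_2d_pt_inv; [|lra].
    now apply (continuity_2d_hTheta sigma m s u u1 u2 u3). }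
  specialize (Hdiff Hc); clear Hc.
  assert (HZc := hz_cont _ _ _ _ _ HZ y t Ht).
  split.
  - eapply is_derive_eq.
    + apply (implicit_derive _ (fun x => Z x t) (fun _ => t) y _ _ 1 0 Hdiff); [lra| | |].
      * rewrite Rabs_R0; lra.
      * now apply continuous_slice.
      * apply filter_forall; intros x.
        rewrite !(hz_eq _ _ _ _ _ HZ) by exact Ht; split; ring.
    + field; lra.
  - eapply is_derive_eq.
    + apply (implicit_derive _ (fun tau => Z y tau) (fun tau => tau) t _ _ 0 1 Hdiff); [lra| | |].
      * rewrite Rabs_R1; lra.
      * apply (continuous_of_2d Z (fun _ => y) (fun tau => tau)); auto.
        -- apply continuous_const.
        -- apply continuous_id.
      * exists (mkposreal t Ht); intros tau Htau.
        change (Rabs (tau - t) < t) in Htau; apply Rabs_def2 in Htau.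
        rewrite !(hz_eq _ _ _ _ _ HZ) by lra; split; ring.
    + field; lra.
Qed.

Lemma hstrip_locally (sigma m : R) s u u1 u2 u3 (y t : R) :
  0 < sigma -> 0 < m -> burgers s u u1 u2 u3 -> hstrip sigma m s u (y, t) ->
  locally y (fun x => hstrip sigma m s u (x, t)).
Proof.
  intros Hsg Hm HB [Ht [H1 H2]]; simpl in *.
  assert (He : 0 < Rmin (y - hY sigma m u 0 t) (hY sigma m u (s t) t - y))
    by (apply Rmin_pos; lra).
  exists (mkposreal _ He); intros x Hx; change (Rabs (x - y) <
    Rmin (y - hY sigma m u 0 t) (hY sigma m u (s t) t - y)) in Hx.
  pose proof (Rmin_l (y - hY sigma m u 0 t) (hY sigma m u (s t) t - y)).
  pose proof (Rmin_r (y - hY sigma m u 0 t) (hY sigma m u (s t) t - y)).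
  apply Rabs_def2 in Hx.
  unfold hstrip, open_dom; simpl; lra.
Qed.

Lemma hodograph_comp_y (sigma m : R) s u u1 u2 u3 Z (G : R -> R -> R) (y t l : R) :
  0 < sigma -> 0 < m -> burgers s u u1 u2 u3 -> hodograph_inv sigma m s u Z ->
  hstrip sigma m s u (y, t) ->
  is_derive (fun z => G z t) (Z y t) l ->
  is_derive (fun x => G (Z x t) t) y (hTheta sigma m u u1 (Z y t) t * l).
Proof.
  intros Hsg Hm HB HZ HS HG.
  apply (is_derive_comp (fun z => G z t) (fun x => Z x t)); [exact HG|].
  now apply (hodograph_Z_derive sigma m s u u1 u2 u3).
Qed.

Lemma exp_hY (sigma m : R) s u u1 u2 u3 (z t : R) :
  0 < sigma -> 0 < m -> burgers s u u1 u2 u3 -> 0 < t ->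
  exp (m * hY sigma m u z t) = hE sigma m u z t.
Proof.
  intros Hsg Hm HB Ht; unfold hY.
  replace (m * (1 / m * ln (hE sigma m u z t))) with (ln (hE sigma m u z t)) by (field; lra).
  apply exp_ln.
  pose proof (hE_pos sigma m s u u1 u2 u3 z t Hsg Hm HB Ht); lra.
Qed.

(* [(1 / theta)_y] as a function of the parameter [z]. *)
Definition hR1 (sigma m : R) (u u1 u2 : R -> R -> R) (z t : R) : R :=
  u2 z t / u1 z t + 2 * m / sigma * u1 z t / hE sigma m u z t.

Lemma hR1_z_derive (sigma m : R) s u u1 u2 u3 (z t : R) :
  0 < sigma -> 0 < m -> burgers s u u1 u2 u3 -> open_dom zero_bd s (z, t) ->
  is_derive (fun x => hR1 sigma m u u1 u2 x t) z
    (u3 z t / u1 z t - u2 z t ^ 2 / u1 z t ^ 2 +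
     2 * m / sigma * (u2 z t / hE sigma m u z t +
       2 * m / sigma * u1 z t ^ 2 / hE sigma m u z t ^ 2)).
Proof.
  intros Hsg Hm HB HD.
  pose proof (hE_pos sigma m s u u1 u2 u3 z t Hsg Hm HB (proj1 HD)) as HE.
  destruct (bg_neg _ _ _ _ _ HB z t (proj1 HD)) as [_ Hu1].
  destruct (bg_z _ _ _ _ _ HB z t HD) as (H0 & H1 & H2).
  (* Once its derivative is known, [E] is made opaque, so that [field] has only [E <> 0] to check
     instead of a condition on [u]. *)
  set (E := fun x => hE sigma m u x t).
  assert (HEd : is_derive E z (- (2 * m / sigma) * u1 z t)).
  { unfold E, hE; auto_derive; [now eexists; eauto|].
    rewrite (is_derive_unique (fun x : R => u x t) z _ H0); field; lra. }
  change (hE sigma m u z t) with (E z) in *.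
  apply (is_derive_ext (fun x => u2 x t / u1 x t + 2 * m / sigma * u1 x t / E x));
    [reflexivity|].
  clearbody E.
  auto_derive.
  - repeat split; try (eexists; eassumption); lra.
  - rewrite (is_derive_unique (fun x : R => u1 x t) z _ H1).
    rewrite (is_derive_unique (fun x : R => u2 x t) z _ H2).
    rewrite (is_derive_unique (fun x : R => E x) z _ HEd).
    field; lra.
Qed.

Lemma hodograph_pde (sigma m : R) s u u1 u2 u3 Z (y t : R) :
  0 < sigma -> 0 < m -> burgers s u u1 u2 u3 -> hodograph_inv sigma m s u Z ->
  hstrip sigma m s u (y, t) ->
  let theta := fun y t => hTheta sigma m u u1 (Z y t) t in
  ex_derive (fun tau => theta y tau) t /\
  ex_derive (fun x => / theta x t) y /\
  ex_derive_n (fun x => / theta x t) 2 y /\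
  Derive (fun tau => theta y tau) t =
    - Derive_n (fun x => / theta x t) 2 y
    - m * Derive (fun x => / theta x t) y + sigma * exp (m * y).
Proof.
  intros Hsg Hm HB HZ HS theta.
  pose proof (hstrip_Z _ _ _ _ _ _ _ _ _ _ Hsg Hm HB HZ HS) as HD.
  pose proof (proj1 HD) as Ht; simpl in Ht.
  assert (Hs := fun tau => bg_continuous s u u1 u2 u3 tau HB).
  assert (Hinv : forall x, hstrip sigma m s u (x, t) ->
            is_derive (fun x => / theta x t) x (hR1 sigma m u u1 u2 (Z x t) t)).
  { intros x HSx.
    pose proof (hstrip_Z _ _ _ _ _ _ _ _ _ _ Hsg Hm HB HZ HSx) as HDx.
    pose proof (hTheta_pos sigma m s u u1 u2 u3 (Z x t) t Hsg Hm HB Ht) as Hp.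
    pose proof (hE_pos sigma m s u u1 u2 u3 (Z x t) t Hsg Hm HB Ht) as HE.
    destruct (bg_neg _ _ _ _ _ HB (Z x t) t Ht) as [_ Hu1].
    eapply is_derive_eq.
    - apply (hodograph_comp_y sigma m s u u1 u2 u3 Z
        (fun z t => / hTheta sigma m u u1 z t)); auto.
      apply is_derive_inv; [|lra].
      now apply (hTheta_z_derive sigma m s u u1 u2 u3).
    - unfold hR1, hTheta_z, hTheta; field; lra. }
  (* The term [theta * u3 / u1] is where [w_zzzz] enters on the space side; it matches the [u3] term
     of [hTheta_t_derive]. *)
  assert (Hyy : is_derive (Derive (fun x => / theta x t)) y
     (hTheta sigma m u u1 (Z y t) t *
      (u3 (Z y t) t / u1 (Z y t) t - u2 (Z y t) t ^ 2 / u1 (Z y t) t ^ 2 +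
     2 * m / sigma * (u2 (Z y t) t / hE sigma m u (Z y t) t +
       2 * m / sigma * u1 (Z y t) t ^ 2 / hE sigma m u (Z y t) t ^ 2)))).
  { apply (is_derive_ext_loc (fun x => hR1 sigma m u u1 u2 (Z x t) t)).
    - eapply filter_imp; [|apply (hstrip_locally sigma m s u u1 u2 u3 y t Hsg Hm HB HS)].
      intros x Hx; symmetry; now apply is_derive_unique, Hinv.
    - apply (hodograph_comp_y sigma m s u u1 u2 u3 Z); auto.
      now apply (hR1_z_derive sigma m s u u1 u2 u3). }
  assert (Htt := chain_rule_curve (hTheta sigma m u u1) (hTheta_z sigma m u u1 u2)
    (fun tau => Z y tau) t _ _
    (locally_2d_open_imp s _ _ _ Hs
      (fun a b => hTheta_z_derive sigma m s u u1 u2 u3 a b Hsg Hm HB) HD)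
    (continuity_2d_hTheta_z sigma m s u u1 u2 u3 _ _ HB Ht)
    (hTheta_t_derive sigma m s u u1 u2 u3 _ _ Hsg Hm HB HD)
    (proj2 (hodograph_Z_derive sigma m s u u1 u2 u3 Z y t Hsg Hm HB HZ HS))).
  split; [eexists; exact Htt|].
  split; [eexists; apply Hinv, HS|].
  split; [eexists; exact Hyy|].
  change (Derive_n (fun x => / theta x t) 2 y) with (Derive (Derive (fun x => / theta x t)) y).
  rewrite (is_derive_unique _ _ _ Hyy).
  rewrite (is_derive_unique (fun x : R => / theta x t) y _ (Hinv y HS)).
  rewrite (is_derive_unique (fun tau : R => theta y tau) t _ Htt).
  assert (Hexp : exp (m * y) = hE sigma m u (Z y t) t).
  { rewrite <- (exp_hY sigma m s u u1 u2 u3) by auto.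
    rewrite <- (hYe_closed sigma m s u (Z y t) t).
    - now rewrite (hz_eq _ _ _ _ _ HZ).
    - destruct HD as [_ HD]; unfold zero_bd in HD; simpl in HD; lra. }
  rewrite Hexp.
  pose proof (hE_pos sigma m s u u1 u2 u3 (Z y t) t Hsg Hm HB Ht) as HE.
  destruct (bg_neg _ _ _ _ _ HB (Z y t) t Ht) as [_ Hu1].
  (* Eliminating [u] in favour of [E] makes the identity rational in [E]. *)
  assert (Hu : u (Z y t) t = sigma / (2 * m) * (1 - hE sigma m u (Z y t) t)).
  { unfold hE; field; lra. }
  rewrite Hu; unfold hR1, hTheta_z, hTheta.
  clear Hu Hexp; revert HE; generalize (hE sigma m u (Z y t) t); intros E HE.
  field; lra.
Qed.

(** * The logarithmic derivative of a solution of the heat equation *)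

Record heat_ext (s : R -> R) (w wz wzz wzzz : R -> R -> R) : Prop := {
  he_s : forall t, 0 < t -> continuous s t /\ 0 < s t;
  he_cont : forall z t, 0 < t -> continuity_2d_pt w z t /\ continuity_2d_pt wz z t /\
    continuity_2d_pt wzz z t /\ continuity_2d_pt wzzz z t;
  he_z : forall z t, open_dom zero_bd s (z, t) ->
    is_derive (fun x => w x t) z (wz z t) /\ is_derive (fun x => wz x t) z (wzz z t) /\
    is_derive (fun x => wzz x t) z (wzzz z t);
  he_t : forall z t, open_dom zero_bd s (z, t) -> is_derive (fun tau => w z tau) t (wzz z t)
}.

(** Bootstrapping: exchanging derivatives of [w] shows that [w_z] solves the heat equation. The
    interior regularity of [w_z] then yields [w_zzzz], and a second exchange, now for [w_z],
    identifies it with [w_zzt]. *)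
Lemma heat_ext_higher s w wz wzz wzzz (z t : R) :
  heat_ext s w wz wzz wzzz -> open_dom zero_bd s (z, t) ->
  is_derive (fun tau => wz z tau) t (wzzz z t) /\
  is_derive (fun x => wzzz x t) z (Derive (fun x => wzzz x t) z) /\
  is_derive (fun tau => wzz z tau) t (Derive (fun x => wzzz x t) z).
Proof.
  intros HH.
  assert (Hs : forall tau, 0 < tau -> continuous s tau)
    by (intros tau Htau; apply (he_s _ _ _ _ _ HH tau Htau)).
  assert (H1 : forall z t, open_dom zero_bd s (z, t) ->
            is_derive (fun tau => wz z tau) t (wzzz z t)).
  { intros a b HD; apply (swap_derivatives w wz wzz wzzz).
    - apply (locally_2d_open_imp s); auto; intros a' b' HD'.
      destruct (he_z _ _ _ _ _ HH a' b' HD') as (K1 & K2 & K3).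
      pose proof (he_t _ _ _ _ _ HH a' b' HD'); auto.
    - apply (he_cont _ _ _ _ _ HH a b (proj1 HD)). }
  assert (H2 : forall z t, open_dom zero_bd s (z, t) ->
     is_derive (fun x => wzzz x t) z (Derive (fun x => wzzz x t) z) /\
     continuity_2d_pt (fun a b => Derive (fun x => wzzz x b) a) z t).
  { intros a b HD.
    destruct (heat_extra_derivative wz wzz wzzz a b) as [K1 K2].
    - apply (locally_2d_open_imp s); auto; intros a' b' HD'.
      destruct (he_z _ _ _ _ _ HH a' b' HD') as (K1 & K2 & K3).
      destruct (he_cont _ _ _ _ _ HH a' b' (proj1 HD')) as (C1 & C2 & C3 & C4).
      split; [|split; [|split; [|split]]]; auto.
    - split; [|exact K2].
      apply Derive_correct, (locally_2d_singleton _ _ _ K1). }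
  intros HD; split; [now apply H1|split; [now apply H2|]].
  apply (swap_derivatives wz wzz wzzz (fun a b => Derive (fun x => wzzz x b) a));
    [|now apply H2].
  apply (locally_2d_open_imp s); auto; intros a' b' HD'.
  destruct (he_z _ _ _ _ _ HH a' b' HD') as (K1 & K2 & K3).
  split; [exact K2|split; [now apply H1|now apply H2]].
Qed.

(** [lu] is [(ln w)_z], and [lu1], [lu2], [lu3] are its successive [z]-derivatives; [lu1] equals
    [theta_den / w ^ 2]. *)
Definition lu (w wz : R -> R -> R) (z t : R) : R := wz z t / w z t.

Definition lu1 (w wz wzz : R -> R -> R) (z t : R) : R := wzz z t / w z t - lu w wz z t ^ 2.

Definition lu2 (w wz wzz wzzz : R -> R -> R) (z t : R) : R :=
  wzzz z t / w z t - wzz z t / w z t * lu w wz z t - 2 * lu w wz z t * lu1 w wz wzz z t.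

Definition lu3 (w wz wzz wzzz wzzzz : R -> R -> R) (z t : R) : R :=
  wzzzz z t / w z t - wzzz z t / w z t * lu w wz z t
  - (wzzz z t / w z t - wzz z t / w z t * lu w wz z t) * lu w wz z t
  - wzz z t / w z t * lu1 w wz wzz z t
  - 2 * lu1 w wz wzz z t ^ 2 - 2 * lu w wz z t * lu2 w wz wzz wzzz z t.

(** The Riccati relation [u_z + u ^ 2 = w_zz / w = (ln w)_t], differentiated in [z], is the Burgers
    equation. *)
Lemma burgers_of_heat s w wz wzz wzzz :
  heat_ext s w wz wzz wzzz ->
  (forall z t, lu w wz (clamp (s t) z) t = lu w wz z t) ->
  (forall z t, 0 < t -> 0 < w z t /\ wz z t <= 0) ->
  (forall z t, 0 < t -> lu1 w wz wzz z t < 0) ->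
  burgers s (lu w wz) (lu1 w wz wzz) (lu2 w wz wzz wzzz)
    (lu3 w wz wzz wzzz (fun z t => Derive (fun x => wzzz x t) z)).
Proof.
  intros HH Hcl Hsg Hneg; split; auto.
  - apply (he_s _ _ _ _ _ HH).
  - intros z t Ht; split; auto.
    destruct (Hsg z t Ht) as [Hw Hwz]; unfold lu.
    apply Rle_div_l; lra.
  - intros z t Ht.
    destruct (Hsg z t Ht) as [Hw Hwz].
    destruct (he_cont _ _ _ _ _ HH z t Ht) as (C1 & C2 & C3 & C4).
    assert (Ci : continuity_2d_pt (fun a b => / w a b) z t)
      by (apply continuity_2d_pt_inv; [exact C1|lra]).
    assert (K0 : continuity_2d_pt (lu w wz) z t) by (apply continuity_2d_pt_mult; auto).
    assert (K1 : continuity_2d_pt (lu1 w wz wzz) z t).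
    { apply (continuity_2d_pt_ext (fun a b => wzz a b * / w a b - lu w wz a b * lu w wz a b)).
      - intros a b; unfold lu1, Rdiv; ring.
      - apply continuity_2d_pt_minus; apply continuity_2d_pt_mult; auto. }
    split; [exact K0|split; [exact K1|]].
    apply continuity_2d_pt_minus; [apply continuity_2d_pt_minus|].
    + apply continuity_2d_pt_mult; auto.
    + apply continuity_2d_pt_mult; [apply continuity_2d_pt_mult|]; auto.
    + apply continuity_2d_pt_mult; [apply continuity_2d_pt_mult|]; auto.
      apply continuity_2d_pt_const.
  - intros z t HD.
    destruct (Hsg z t (proj1 HD)) as [Hw _].
    destruct (he_z _ _ _ _ _ HH z t HD) as (Z1 & Z2 & Z3).
    destruct (heat_ext_higher _ _ _ _ _ z t HH HD) as (_ & Z4 & _).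
    assert (D0 : is_derive (fun x => lu w wz x t) z (lu1 w wz wzz z t)).
    { unfold lu1, lu; auto_derive.
      - repeat split; try (eexists; eassumption); lra.
      - rewrite (is_derive_unique (fun x : R => w x t) z _ Z1).
        rewrite (is_derive_unique (fun x : R => wz x t) z _ Z2); field; lra. }
    assert (D1 : is_derive (fun x => lu1 w wz wzz x t) z (lu2 w wz wzz wzzz z t)).
    { unfold lu1 at 1; auto_derive.
      - repeat split; try (eexists; eassumption); lra.
      - rewrite (is_derive_unique (fun x : R => w x t) z _ Z1).
        rewrite (is_derive_unique (fun x : R => wzz x t) z _ Z3).
        rewrite (is_derive_unique (fun x : R => lu w wz x t) z _ D0).
        unfold lu2, lu; field; lra. }
    split; [exact D0|split; [exact D1|]].
    unfold lu2 at 1; auto_derive.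
    + repeat split; try (eexists; eassumption); lra.
    + rewrite (is_derive_unique (fun x : R => w x t) z _ Z1).
      rewrite (is_derive_unique (fun x : R => wzz x t) z _ Z3).
      rewrite (is_derive_unique (fun x : R => lu w wz x t) z _ D0).
      rewrite (is_derive_unique (fun x : R => lu1 w wz wzz x t) z _ D1).
      unfold lu3, lu; field; lra.
  - intros z t HD.
    destruct (Hsg z t (proj1 HD)) as [Hw _].
    pose proof (he_t _ _ _ _ _ HH z t HD) as T1.
    destruct (heat_ext_higher _ _ _ _ _ z t HH HD) as (T2 & _ & T3).
    assert (D0 : is_derive (fun tau => lu w wz z tau) t
              (lu2 w wz wzz wzzz z t + 2 * lu w wz z t * lu1 w wz wzz z t)).
    { unfold lu2, lu; auto_derive.
      - repeat split; try (eexists; eassumption); lra.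
      - rewrite (is_derive_unique (fun x : R => w z x) t _ T1).
        rewrite (is_derive_unique (fun x : R => wz z x) t _ T2); field; lra. }
    split; [exact D0|].
    unfold lu1 at 1; auto_derive.
    + repeat split; try (eexists; eassumption); lra.
    + rewrite (is_derive_unique (fun x : R => w z x) t _ T1).
      rewrite (is_derive_unique (fun x : R => wzz z x) t _ T3).
      rewrite (is_derive_unique (fun x : R => lu w wz z x) t _ D0).
      unfold lu3, lu2, lu1, lu; field; lra.
Qed.

(** A continuous function without zeros keeps its sign. Were [u_z] positive, [u] would increase and
    [E] decrease from [z = 0] to [z = s t], contradicting the order of the two values of [y]. *)
Lemma lu1_negative (sigma m : R) s w wz wzz wzzz (t : R) :
  0 < sigma -> 0 < m -> heat_ext s w wz wzz wzzz ->
  (forall z, 0 < w z t /\ wz z t <= 0) ->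
  (forall z, lu1 w wz wzz z t <> 0) -> 0 < t ->
  hY sigma m (lu w wz) 0 t < hY sigma m (lu w wz) (s t) t ->
  forall z, lu1 w wz wzz z t < 0.
Proof.
  intros Hsg Hm HH Hw Hn Ht HY z.
  destruct (he_s _ _ _ _ _ HH t Ht) as [_ Hs].
  assert (Hc : forall x, continuity_2d_pt (lu w wz) x t /\ continuity_2d_pt (lu1 w wz wzz) x t).
  { intros x; destruct (he_cont _ _ _ _ _ HH x t Ht) as (C1 & C2 & C3 & C4).
    assert (Ci : continuity_2d_pt (fun a b => / w a b) x t)
      by (apply continuity_2d_pt_inv; [exact C1|specialize (Hw x); lra]).
    assert (K0 : continuity_2d_pt (lu w wz) x t) by (apply continuity_2d_pt_mult; auto).
    split; [exact K0|].
    apply (continuity_2d_pt_ext (fun a b => wzz a b * / w a b - lu w wz a b * lu w wz a b)).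
    - intros a b; unfold lu1, Rdiv; ring.
    - apply continuity_2d_pt_minus; apply continuity_2d_pt_mult; auto. }
  apply Rnot_le_lt; intros Hz.
  assert (Hpos : forall x, 0 < lu1 w wz wzz x t).
  { intros x; apply Rnot_le_lt; intros Hx.
    destruct (IVT_gen (fun a => lu1 w wz wzz a t) z x 0) as [c [_ Hc0]].
    - intros a; apply continuity_pt_filterlim, (continuous_slice (lu1 w wz wzz)), Hc.
    - split; [eapply Rle_trans; [apply Rmin_r|exact Hx]|
              eapply Rle_trans; [exact Hz|apply Rmax_l]].
    - exact (Hn c Hc0). }
  destruct (MVT_gen (fun a => lu w wz a t) 0 (s t) (fun a => lu1 w wz wzz a t)) as [c [_ Hc2]].
  - rewrite Rmin_left, Rmax_right by lra; intros x Hx.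
    assert (HD : open_dom zero_bd s (x, t)) by (split; unfold zero_bd; simpl; lra).
    destruct (he_z _ _ _ _ _ HH x t HD) as (Z1 & Z2 & _); specialize (Hw x).
    unfold lu1, lu; auto_derive.
    + repeat split; try (eexists; eassumption); lra.
    + rewrite (is_derive_unique (fun x : R => w x t) x _ Z1).
      rewrite (is_derive_unique (fun x : R => wz x t) x _ Z2); field; lra.
  - intros x _; apply continuity_pt_filterlim, (continuous_slice (lu w wz)), Hc.
  - assert (0 < lu1 w wz wzz c t * (s t - 0)) by (apply Rmult_lt_0_compat; [apply Hpos|lra]).
    assert (Hk : 0 < 2 * m / sigma) by (apply Rdiv_lt_0_compat; lra).
    assert (Hus : lu w wz (s t) t <= 0).
    { unfold lu; specialize (Hw (s t)); apply Rle_div_l; lra. }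
    assert (HE : 1 <= hE sigma m (lu w wz) (s t) t < hE sigma m (lu w wz) 0 t)
      by (unfold hE; nra).
    assert (ln (hE sigma m (lu w wz) (s t) t) < ln (hE sigma m (lu w wz) 0 t))
      by (apply ln_increasing; lra).
    unfold hY in HY.
    assert (0 < 1 / m) by (apply Rdiv_lt_0_compat; lra).
    nra.
Qed.

(** * Time derivatives along the two boundaries, and the boundary fluxes *)

Lemma boundary_room (s : R -> R) (t0 : R) :
  (forall t, 0 < t -> continuous s t /\ 0 < s t) -> 0 < t0 ->
  exists d, 0 < d /\ forall t delta, Rabs (t - t0) < d -> 0 < delta < d -> delta < s t.
Proof.
  intros Hs Ht0; destruct (Hs t0 Ht0) as [Hc Hp].
  destruct (continuous_abs_lt s t0 (s t0 / 2) Hc) as [d [Hd H]]; [lra|].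
  exists (Rmin d (s t0 / 2)); split; [apply Rmin_pos; lra|]; intros t delta Ht Hdelta.
  pose proof (Rmin_l d (s t0 / 2)); pose proof (Rmin_r d (s t0 / 2)).
  specialize (H t ltac:(lra)); apply Rabs_def2 in H; lra.
Qed.

Lemma fixed_boundary_derive s f fz ft (t : R) :
  (forall t, 0 < t -> continuous s t /\ 0 < s t) ->
  c1_up_to_boundary s f fz ft -> 0 < t ->
  is_derive (fun tau => f 0 tau) t (ft 0 t).
Proof.
  intros Hs Hf Ht.
  apply is_derive_eq with (fz 0 t * 0 + ft 0 t); [|ring].
  (* The sign [1] pushes the curve [z = 0] to the right, into the domain. *)
  apply (boundary_derive s f fz ft (fun _ => 0) (fun _ => 0) 1); auto.
  - intros tau Htau; now apply Hs.
  - intros tau _; apply (is_derive_const 0 tau).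
  - apply continuous_const.
  - rewrite Rabs_R1; lra.
  - destruct (boundary_room s t Hs Ht) as [d [Hd H]].
    exists d; split; [exact Hd|]; intros t' delta Ht' Hdelta.
    specialize (H t' delta Ht' Hdelta); lra.
Qed.

Lemma free_boundary_derive s ds f fz ft (t : R) :
  (forall t, 0 < t -> continuous s t /\ 0 < s t) ->
  (forall t, 0 < t -> is_derive s t (ds t)) -> continuous ds t ->
  c1_up_to_boundary s f fz ft -> 0 < t ->
  is_derive (fun tau => f (s tau) tau) t (fz (s t) t * ds t + ft (s t) t).
Proof.
  intros Hs Hds Hc Hf Ht.
  (* The sign [-1] pushes the free boundary to the left, into the domain. *)
  apply (boundary_derive s f fz ft s ds (-1)); auto.
  - intros tau Htau; now apply Hs.
  - apply Rabs_le; lra.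
  - destruct (boundary_room s t Hs Ht) as [d [Hd H]].
    exists d; split; [exact Hd|]; intros t' delta Ht' Hdelta.
    specialize (H t' delta Ht' Hdelta); lra.
Qed.

Lemma filterlim_Rdiv {T} (F : (T -> Prop) -> Prop) {FF : Filter F} (f g : T -> R) (a b : R) :
  b <> 0 -> filterlim f F (locally a) -> filterlim g F (locally b) ->
  filterlim (fun x => f x / g x) F (locally (a / b)).
Proof.
  intros Hb Hf Hg.
  apply (filterlim_comp_2 (G := locally a) (H := locally (/ b)) f (fun x => / g x) Rmult).
  - exact Hf.
  - apply (filterlim_comp _ _ _ g Rinv _ (locally b)); [exact Hg|].
    now apply (continuous_Rinv b).
  - exact (filterlim_mult a (/ b)).
Qed.

Lemma cont2_on_of_2d (a b : R -> R) (f : R -> R -> R) :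
  (forall z t, 0 < t -> continuity_2d_pt f z t) -> cont2_on (closed_dom a b) f.
Proof.
  intros H [z t] [Ht _].
  eapply filterlim_filter_le_1; [apply filter_le_within|].
  now apply (continuity_2d_pt_filterlim f), H.
Qed.

Lemma burgers_c1 s u u1 u2 u3 :
  burgers s u u1 u2 u3 -> c1_up_to_boundary s u u1 (fun z t => u2 z t + 2 * u z t * u1 z t).
Proof.
  intros HB; split; intros z t H; try apply (bg_z _ _ _ _ _ HB z t H);
    try apply (bg_t _ _ _ _ _ HB z t H);
    destruct (bg_cont _ _ _ _ _ HB z t H) as (C0 & C1 & C2); auto.
  apply continuity_2d_pt_plus; [exact C2|].
  apply continuity_2d_pt_mult; [apply continuity_2d_pt_mult|]; auto.
  apply continuity_2d_pt_const.
Qed.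

Lemma heat_c1 s w wz wzz wzzz : heat_ext s w wz wzz wzzz -> c1_up_to_boundary s w wz wzz.
Proof.
  intros HH; split; intros z t H; try apply (he_cont _ _ _ _ _ HH z t H).
  - apply (he_z _ _ _ _ _ HH z t H).
  - apply (he_t _ _ _ _ _ HH z t H).
Qed.

Lemma hodograph_inv_hY (sigma m : R) s u u1 u2 u3 Z (z t : R) :
  0 < sigma -> 0 < m -> burgers s u u1 u2 u3 -> hodograph_inv sigma m s u Z ->
  0 < t -> 0 <= z <= s t -> Z (hY sigma m u z t) t = z.
Proof.
  intros Hsg Hm HB HZ Ht Hz.
  pose proof (hz_eq _ _ _ _ _ HZ (hY sigma m u z t) t Ht) as H.
  rewrite <- (hYe_closed sigma m s u z t Hz) in H at 2.
  assert (Hinc := fun a b => hYe_increasing sigma m s u u1 u2 u3 a b t Hsg Hm HB Ht).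
  destruct (Rtotal_order (Z (hY sigma m u z t) t) z) as [Hlt|[Heq|Hgt]]; [|exact Heq|].
  - specialize (Hinc _ _ Hlt); lra.
  - specialize (Hinc _ _ Hgt); lra.
Qed.

(** These are the two terms shared by the integrands of [I_0] and [I_1], with [theta_y] written as
    [hTheta * hTheta_z]. Their sum is [(2 / sigma) * u_t] by the Burgers equation. *)
Lemma hTheta_flux (sigma m : R) s u u1 u2 u3 (z t : R) :
  0 < sigma -> 0 < m -> burgers s u u1 u2 u3 -> 0 < t ->
  hE sigma m u z t *
    (sigma * (hE sigma m u z t - 1) / (m * hTheta sigma m u u1 z t)) =
    4 / sigma * u z t * u1 z t /\
  hE sigma m u z t *
    ((hTheta sigma m u u1 z t * hTheta_z sigma m u u1 u2 z t - m * hTheta sigma m u u1 z t) /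
     hTheta sigma m u u1 z t ^ 3) = 2 / sigma * u2 z t.
Proof.
  intros Hsg Hm HB Ht.
  pose proof (hE_pos sigma m s u u1 u2 u3 z t Hsg Hm HB Ht) as HE.
  destruct (bg_neg _ _ _ _ _ HB z t Ht) as [_ Hu1].
  assert (Hu : u z t = sigma / (2 * m) * (1 - hE sigma m u z t)) by (unfold hE; field; lra).
  rewrite Hu; unfold hTheta_z, hTheta.
  clear Hu; revert HE; generalize (hE sigma m u z t); intros E HE.
  split; field; lra.
Qed.

(** * Verification of the parametric form and of the equations of the transformed problem *)

Theorem theorem2p9 (sigma m eps : R) (L v wm h : R -> R)
    (w wz wt wzz : R -> R -> R) (s : R -> R)
    (Hsigma : 0 < sigma) (Hm : 0 < m) (Heps : eps = 0 \/ eps = 1)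
    (Hdata : P1_data L v wm h)
    (Hsol : P1_solution eps L v wm h w wz wt wzz s)
    (Hsign : sign_conditions w wz s)
    (Hreg : regular_to_boundary wzz s)
    (Hcorner : corner_compatible wm w wz s)
    (Hnd : nondegenerate sigma m w wz wzz s) :
  exists theta : R -> R -> R,
    parametric_form sigma m w wz wzz s theta
      (Y0_of sigma m w wz) (Y1_of sigma m w wz s) /\
    P4_solution sigma m eps L v wm h theta
      (Y0_of sigma m w wz) (Y1_of sigma m w wz s).
Proof.
  destruct Hreg as [Cwzz [wzzz [Dwzzz Cwzzz]]].
  destruct Hnd as [Hden HY01].
  destruct Hcorner as (Hwm0 & Hw0 & Hwz0 & Hwzs).
  assert (Hs : forall t, 0 < t -> continuous s t /\ 0 < s t).
  { intros t Ht; split; [|now apply (P1_s_pos _ _ _ _ _ _ _ _ _ _ Hsol)].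
    apply (ex_derive_continuous s), (P1_stefan _ _ _ _ _ _ _ _ _ _ Hsol t Ht). }
  assert (Hsc : forall t, 0 < t -> continuous s t) by (intros; now apply Hs).
  set (W := ext s w); set (WZ := ext s wz); set (WZZ := ext s wzz); set (WZZZ := ext s wzzz).
  assert (Hext : forall f z t, open_dom zero_bd s (z, t) -> ext s f z t = f z t)
    by (intros; now apply ext_on_closed, open_dom_closed).
  assert (HH : heat_ext s W WZ WZZ WZZZ).
  { split; [exact Hs| | |].
    - intros z t Ht; repeat split; apply continuity_2d_pt_clamped; auto; apply Hsol.
    - intros z t HD; unfold W, WZ, WZZ, WZZZ.
      rewrite !Hext by exact HD.
      split; [|split]; apply is_derive_ext_z; auto.
      + now apply (P1_wz _ _ _ _ _ _ _ _ _ _ Hsol).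
      + now apply (P1_wzz _ _ _ _ _ _ _ _ _ _ Hsol).
    - intros z t HD; unfold W, WZZ.
      rewrite Hext by exact HD.
      apply is_derive_ext_t; auto.
      rewrite (P1_heat _ _ _ _ _ _ _ _ _ _ Hsol z t HD).
      now apply (P1_wt _ _ _ _ _ _ _ _ _ _ Hsol). }
  assert (Hcl : forall z t, 0 < t -> closed_dom zero_bd s (clamp (s t) z, t)).
  { intros z t Ht; split; [exact Ht|]; apply clamp_in; now apply Hs. }
  assert (Hc : forall z t, 0 < t -> 0 <= z <= s t -> closed_dom zero_bd s (z, t))
    by (intros z t Ht Hz; split; [exact Ht|exact Hz]).
  assert (Hsg : forall z t, 0 < t -> 0 < W z t /\ WZ z t <= 0).
  { intros z t Ht; apply (Hsign _ _ (Hcl z t Ht)). }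
  set (u := lu W WZ); set (u1 := lu1 W WZ WZZ); set (u2 := lu2 W WZ WZZ WZZZ).
  assert (Hy : forall z t, closed_dom zero_bd s (z, t) ->
            y_par sigma m w wz z t = hY sigma m u z t).
  { intros z t HD; unfold y_par, hY, hE, u, lu, W, WZ.
    rewrite !ext_on_closed by exact HD.
    destruct (Hsign z t HD) as [Hw _].
    do 3 f_equal; field; lra. }
  assert (HY0 : forall t, 0 < t -> Y0_of sigma m w wz t = hY sigma m u 0 t).
  { intros t Ht; apply Hy, Hc; auto; pose proof (proj2 (Hs t Ht)); lra. }
  assert (HY1 : forall t, 0 < t -> Y1_of sigma m w wz s t = hY sigma m u (s t) t).
  { intros t Ht; apply Hy, Hc; auto; pose proof (proj2 (Hs t Ht)); lra. }
  assert (Hu1 : forall z t, 0 < t ->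
            u1 z t = theta_den w wz wzz (clamp (s t) z) t / w (clamp (s t) z) t ^ 2).
  { intros z t Ht; unfold u1, lu1, lu, theta_den, W, WZ, WZZ, ext.
    destruct (Hsign _ _ (Hcl z t Ht)) as [Hw _]; field; lra. }
  assert (Hneg : forall z t, 0 < t -> u1 z t < 0).
  { intros z t Ht; apply (lu1_negative sigma m s W WZ WZZ WZZZ t Hsigma Hm HH); auto.
    - intros x; fold u1; rewrite Hu1 by exact Ht.
      destruct (Hsign _ _ (Hcl x t Ht)) as [Hw _].
      apply Rmult_integral_contrapositive_currified; [now apply Hden, Hcl|].
      apply Rinv_neq_0_compat, pow_nonzero; lra.
    - fold u; rewrite <- HY0, <- HY1 by exact Ht; now apply HY01. }
  assert (HB : burgers s u u1 u2 (lu3 W WZ WZZ WZZZ (fun z t => Derive (fun x => WZZZ x t) z))).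
  { apply burgers_of_heat; auto; intros z t; unfold lu, W, WZ, ext.
    (* [bg_clamp] also covers times [t <= 0], where [s t] may be negative; [clamp] is then
       constantly 0. *)
    destruct (Rle_lt_dec (s t) 0) as [Hle|Hlt].
    - replace (clamp (s t) (clamp (s t) z)) with (clamp (s t) z); [reflexivity|].
      unfold clamp, Rmax, Rmin; repeat destruct Rle_dec; lra.
    - rewrite (clamp_id (s t) (clamp (s t) z)) by now apply clamp_in.
      reflexivity. }
  revert HB; generalize (lu3 W WZ WZZ WZZZ (fun z t => Derive (fun x => WZZZ x t) z)).
  intros u3 HB.
  destruct (hodograph_inverse sigma m s u u1 u2 u3 Hsigma Hm HB) as [Z [HZ1 HZ2]].
  assert (HZ : hodograph_inv sigma m s u Z) by (split; auto).
  assert (HZY := fun z t => hodograph_inv_hY sigma m s u u1 u2 u3 Z z t Hsigma Hm HB HZ).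
  assert (Hexp := fun z t => exp_hY sigma m s u u1 u2 u3 z t Hsigma Hm HB).
  assert (HE := fun z t => hE_pos sigma m s u u1 u2 u3 z t Hsigma Hm HB).
  set (theta := fun y t => hTheta sigma m u u1 (Z y t) t).
  (* [theta_y = hTheta_z * Z_y] with [Z_y = hTheta]. This form is continuous up to the edges of the
     strip because [Z] is. *)
  set (thetay := fun y t =>
    hTheta sigma m u u1 (Z y t) t * hTheta_z sigma m u u1 u2 (Z y t) t).
  assert (Hopen : forall y t, open_dom (Y0_of sigma m w wz) (Y1_of sigma m w wz s) (y, t) ->
            hstrip sigma m s u (y, t)).
  { intros y t [Ht HD]; simpl in *; rewrite HY0, HY1 in HD by exact Ht; split; auto. }
  assert (Hends : forall t, 0 < t -> 0 <= 0 <= s t /\ 0 <= s t <= s t).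
  { intros t Ht; pose proof (proj2 (Hs t Ht)); lra. }
  assert (Cu : forall c, (forall t, 0 < t -> continuous c t) -> forall t, 0 < t ->
            continuous (fun t => u (c t) t) t /\ continuous (fun t => u1 (c t) t) t /\
            continuous (fun t => u2 (c t) t) t).
  { intros c Hcc t Ht; destruct (bg_cont _ _ _ _ _ HB (c t) t Ht) as (C0 & C1 & C2).
    repeat split.
    - apply (continuous_of_2d u c (fun t => t)); auto; apply continuous_id.
    - apply (continuous_of_2d u1 c (fun t => t)); auto; apply continuous_id.
    - apply (continuous_of_2d u2 c (fun t => t)); auto; apply continuous_id. }
  (* The Stefan condition is solved for the derivative of [s], whose continuity follows from that of
     [L] and of the trace of [w_z]. *)
  assert (Cds : forall t, 0 < t -> is_derive s t (- WZ (s t) t / L t) /\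
            continuous (fun t => - WZ (s t) t / L t) t).
  { intros t Ht; destruct (P1_L _ _ _ _ Hdata t Ht) as [CL HL].
    destruct (P1_stefan _ _ _ _ _ _ _ _ _ _ Hsol t Ht) as [Ds Es]; split.
    - apply is_derive_eq with (Derive s t); [now apply Derive_correct|].
      unfold WZ; rewrite ext_on_closed by (apply Hc; auto; now apply Hends).
      rewrite Es; field; lra.
    - apply (continuous_mult (fun t => - WZ (s t) t) (fun t => / L t)).
      + apply (continuous_opp (fun t => WZ (s t) t)).
        apply (continuous_of_2d WZ s (fun t => t)); auto; [|apply continuous_id].
        apply (he_cont _ _ _ _ _ HH _ _ Ht).
      + apply (continuous_comp L Rinv); [exact CL|].
        apply continuous_Rinv; lra. }
  assert (Hws : forall t, 0 < t -> W (s t) t = wm t).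
  { intros t Ht; unfold W; rewrite ext_on_closed by (apply Hc; auto; now apply Hends).
    now apply (P1_free _ _ _ _ _ _ _ _ _ _ Hsol). }
  assert (Hpos0 : forall P : R -> Prop, (forall t, 0 < t -> P t) -> at_right 0 P).
  { intros P HP; exists (mkposreal 1 Rlt_0_1); intros t _ Ht; now apply HP. }
  (* This limit and the next are the lower limits of the antiderivatives in the equations for [Y0]
     and [Y1]. *)
  assert (Hu0 : filterlim (fun t => u 0 t) (at_right 0) (locally 0)).
  { apply (filterlim_ext_loc (fun t => wz 0 t / w 0 t)).
    - apply Hpos0; intros t Ht; unfold u, lu, W, WZ.
      rewrite !ext_on_closed by (apply Hc; auto; now apply Hends); reflexivity.
    - replace 0 with (0 / wm 0) at 2 by (field; lra).
      apply filterlim_Rdiv; auto; try lra; typeclasses eauto. }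
  assert (Hus : filterlim (fun t => u (s t) t) (at_right 0) (locally 0)).
  { apply (filterlim_ext_loc (fun t => wz (s t) t / wm t)).
    - apply Hpos0; intros t Ht; unfold u, lu; rewrite Hws by exact Ht; unfold WZ.
      rewrite !ext_on_closed by (apply Hc; auto; now apply Hends); reflexivity.
    - replace 0 with (0 / wm 0) at 2 by (field; lra).
      apply filterlim_Rdiv; auto; [typeclasses eauto|lra|apply Hdata]. }
  assert (Hflux := fun z t => hTheta_flux sigma m s u u1 u2 u3 z t Hsigma Hm HB).
  exists theta; split; [split|].
  - intros y t [Ht HD]; simpl in Ht, HD.
    rewrite HY0, HY1 in HD by exact Ht.
    destruct (hodograph_strip sigma m s u u1 u2 u3 Z y t Hsigma Hm HB HZ1 Ht) as [_ HS].
    apply HS in HD.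
    exists (Z y t); split.
    + split; [exact HD|].
      rewrite Hy, <- (hYe_closed sigma m s u) by auto.
      now rewrite HZ1.
    + intros z [Hz ->]; rewrite Hy by auto; now apply HZY.
  - intros z t HD; pose proof HD as [Ht Hz]; unfold zero_bd in Hz; simpl in Ht, Hz.
    rewrite Hy, HY0, HY1 by auto.
    destruct (hodograph_strip sigma m s u u1 u2 u3 Z (hY sigma m u z t) t
      Hsigma Hm HB HZ1 Ht) as [_ HS].
    unfold theta; rewrite HZY in * by auto.
    split; [now apply HS|].
    destruct (Hsign z t HD) as [Hw _].
    pose proof (Hden z t HD) as Hd.
    unfold hTheta, theta_par; rewrite Hu1, clamp_id by auto.
    unfold hE, u, lu, W, WZ; rewrite !ext_on_closed by exact HD.
    field; repeat split; lra.
  - exists thetay; split.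
    + exact HY01.
    + apply cont2_on_of_2d; intros y t Ht.
      apply (continuity_2d_pt_comp2 (hTheta sigma m u u1) Z (fun _ t => t)).
      * now apply (continuity_2d_hTheta sigma m s u u1 u2 u3).
      * now apply HZ2.
      * apply continuity_2d_pt_id2.
    + intros y t [Ht _].
      pose proof (hTheta_pos sigma m s u u1 u2 u3 (Z y t) t Hsigma Hm HB Ht).
      unfold theta; lra.
    + intros y t HD; apply Hopen in HD.
      apply (hodograph_comp_y sigma m s u u1 u2 u3 Z); auto.
      apply (hTheta_z_derive sigma m s u u1 u2 u3); auto.
      now apply (hstrip_Z sigma m s u u1 u2 u3).
    + apply cont2_on_of_2d; intros y t Ht.
      apply (continuity_2d_pt_comp2
        (fun z t => hTheta sigma m u u1 z t * hTheta_z sigma m u u1 u2 z t) Z (fun _ t => t)).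
      * apply continuity_2d_pt_mult.
        -- now apply (continuity_2d_hTheta sigma m s u u1 u2 u3).
        -- now apply (continuity_2d_hTheta_z sigma m s u u1 u2 u3).
      * now apply HZ2.
      * apply continuity_2d_pt_id2.
    + intros y t HD; apply Hopen in HD.
      now apply (hodograph_pde sigma m s u u1 u2 u3).
    + intros t Ht.
      (* This is [(E - 1) / m] on the free boundary, so that [1 + m * I1 = E = exp (m * Y1)]. The
         product with 0 is the limit at the corner. *)
      exists (- (2 / sigma) * u (s t) t - - (2 / sigma) * 0); split; [|split].
      * apply (is_int_from_0_derive (fun t => - (2 / sigma) * u (s t) t)
          (fun t => - (2 / sigma) * (u1 (s t) t * (- WZ (s t) t / L t) +
             (u2 (s t) t + 2 * u (s t) t * u1 (s t) t)))); [| | | |exact Ht].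
        -- intros x Hx; apply (is_derive_scal (fun t => u (s t) t)).
           apply (free_boundary_derive s (fun t => - WZ (s t) t / L t) u u1
             (fun z t => u2 z t + 2 * u z t * u1 z t)); auto.
           ++ intros; now apply Cds.
           ++ now apply Cds.
           ++ now apply (burgers_c1 s u u1 u2 u3).
        -- intros x Hx; destruct (Cu s Hsc x Hx) as (C0 & C1 & C2).
           apply (continuous_mult (fun _ => - (2 / sigma))); [apply continuous_const|].
           apply (continuous_plus (fun t => u1 (s t) t * (- WZ (s t) t / L t))).
           ++ apply (continuous_mult (fun t => u1 (s t) t)); [exact C1|now apply Cds].
           ++ apply (continuous_plus (fun t => u2 (s t) t)); [exact C2|].
              apply (continuous_mult (fun t => 2 * u (s t) t)); [|exact C1].
              apply (continuous_mult (fun _ => 2)); [apply continuous_const|exact C0].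
        -- intros x Hx; unfold I1_integrand, theta, thetay.
           rewrite HY1, HZY, Hexp by (auto; now apply Hends).
           destruct (Hflux (s x) x Hx) as [F1 F2].
           rewrite Rmult_minus_distr_l, F2, <- Rmult_assoc, F1.
           destruct (P1_L _ _ _ _ Hdata x Hx) as [_ HL].
           destruct (Hsg (s x) x Hx) as [HW _].
           rewrite <- Hws by exact Hx.
           (* The derivative of [s] becomes [- u * w_m / L], and its product with [u1] is the source
              of the factor [w_m / (2 * L)]. *)
           replace (WZ (s x) x) with (u (s x) x * W (s x) x) by (unfold u, lu; field; lra).
           field; lra.
        -- exact (filterlim_comp _ _ _ _ (fun y => - (2 / sigma) * y) _ _ _ Hus
             (continuous_mult (fun _ => - (2 / sigma)) (fun y => y) 0
               (continuous_const _ _) (continuous_id _))).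
      * specialize (HE (s t) t Ht); unfold hE in HE.
        replace (1 + m * (- (2 / sigma) * u (s t) t - - (2 / sigma) * 0))
          with (1 - 2 * m / sigma * u (s t) t) by (field; lra); lra.
      * rewrite HY1 by exact Ht; unfold hY, hE.
        replace (1 + m * (- (2 / sigma) * u (s t) t - - (2 / sigma) * 0))
          with (1 - 2 * m / sigma * u (s t) t) by (field; lra).
        field; lra.
    + intros t Ht.
      destruct (P1_L _ _ _ _ Hdata t Ht) as [_ HL].
      destruct (Hsg (s t) t Ht) as [HW _].
      pose proof (Hneg (s t) t Ht) as Hn; pose proof (HE (s t) t Ht) as HEt.
      assert (Dwm : Derive wm t = WZ (s t) t * (- WZ (s t) t / L t) + WZZ (s t) t).
      { apply is_derive_unique, (is_derive_ext_loc (fun t => W (s t) t)).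
        - exists (mkposreal t Ht); intros x Hx; change (Rabs (x - t) < t) in Hx.
          apply Rabs_def2 in Hx; apply Hws; lra.
        - apply (free_boundary_derive s (fun t => - WZ (s t) t / L t) W WZ WZZ); auto.
          + intros; now apply Cds.
          + now apply Cds.
          + now apply (heat_c1 s W WZ WZZ WZZZ). }
      (* Differentiating [w (s t) t = w_m t] gave [w_m' / w_m = w_zz / w - u ^ 2 * w_m / L], while
         [sigma * (E - 1) ^ 2 / (2 * m ^ 2) = 2 * u ^ 2 / sigma]; the terms with [L] cancel. *)
      assert (Hbr : Y1_bracket sigma m L wm (Y1_of sigma m w wz s) t = - (2 / sigma) * u1 (s t) t).
      { unfold Y1_bracket; rewrite HY1, Hexp, Dwm by exact Ht.
        rewrite <- Hws by exact Ht.
        unfold hE, u1, lu1; fold u.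
        replace (WZ (s t) t) with (u (s t) t * W (s t) t) by (unfold u, lu; field; lra).
        field; lra. }
      assert (0 < 2 / sigma) by (apply Rdiv_lt_0_compat; lra).
      rewrite Hbr; split; [nra|].
      unfold theta; rewrite HY1, HZY, Hexp by (auto; now apply Hends).
      unfold hTheta; field; lra.
    + intros t Ht.
      (* With [exp J = w (0, t) / w_m (0)] the right-hand side becomes [h * eps * w - w_z] at
         [z = 0], and the equation is the fixed boundary condition. *)
      exists (ln (W 0 t) - ln (wm 0)); split.
      * apply (is_int_from_0_derive (fun t => ln (W 0 t)) (fun t => u 0 t ^ 2 + u1 0 t));
          [| | | |exact Ht].
        -- intros x Hx; destruct (Hsg 0 x Hx) as [HW _].
           pose proof (fixed_boundary_derive s W WZ WZZ x Hs (heat_c1 _ _ _ _ _ HH) Hx) as HD.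
           auto_derive; [split; [eexists; exact HD|tauto]|].
           rewrite (is_derive_unique (fun x : R => W 0 x) x _ HD).
           unfold u1, lu1; fold u; field; lra.
        -- intros x Hx.
           destruct (Cu (fun _ => 0) (fun _ _ => continuous_const _ _) x Hx) as (C0 & C1 & _).
           apply (continuous_plus (fun t => u 0 t ^ 2)); [|exact C1].
           apply (continuous_ext (fun t => u 0 t * u 0 t));
             [intros y; change (u 0 y * u 0 y = u 0 y ^ 2); ring|].
           now apply (continuous_mult (fun t => u 0 t)).
        -- intros x Hx; unfold robin_integrand, theta.
           rewrite HY0, HZY, Hexp by (auto; now apply Hends).
           pose proof (HE 0 x Hx) as HEx; pose proof (Hneg 0 x Hx).
           assert (Hu : u 0 x = sigma / (2 * m) * (1 - hE sigma m u 0 x))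
             by (unfold hE; field; lra).
           rewrite Hu; unfold hTheta; clear Hu.
           revert HEx; generalize (hE sigma m u 0 x); intros E0 HE0.
           field; lra.
        -- apply (filterlim_ext_loc (fun t => ln (w 0 t))).
           ++ apply Hpos0; intros x Hx; unfold W.
              rewrite ext_on_closed by (apply Hc; auto; now apply Hends); reflexivity.
           ++ apply (filterlim_comp _ _ _ _ ln _ _ _ Hw0).
              apply (ex_derive_continuous ln); exists (/ wm 0); now apply is_derive_ln.
      * destruct (Hsg 0 t Ht) as [HW _].
        pose proof (P1_fixed _ _ _ _ _ _ _ _ _ _ Hsol t Ht) as Hf.
        assert (HD : closed_dom zero_bd s (0, t)) by (apply Hc; auto; now apply Hends).
        replace (exp (ln (W 0 t) - ln (wm 0))) with (W 0 t / wm 0).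
        2: { unfold Rminus; rewrite exp_plus, exp_Ropp, !exp_ln by lra; reflexivity. }
        rewrite HY0, Hexp by exact Ht.
        unfold hE, u, lu, W, WZ in *; rewrite !ext_on_closed in * by exact HD.
        rewrite Hf; field; lra.
    + intros t Ht.
      (* Again [(E - 1) / m], now at [z = 0]; as the boundary is at rest, its derivative is
         [- (2 / sigma) * u_t]. *)
      exists (- (2 / sigma) * u 0 t - - (2 / sigma) * 0); split; [|split].
      * apply (is_int_from_0_derive (fun t => - (2 / sigma) * u 0 t)
          (fun t => - (2 / sigma) * (u2 0 t + 2 * u 0 t * u1 0 t))); [| | | |exact Ht].
        -- intros x Hx; apply (is_derive_scal (fun t => u 0 t)).
           apply (fixed_boundary_derive s u u1 (fun z t => u2 z t + 2 * u z t * u1 z t)); auto.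
           now apply (burgers_c1 s u u1 u2 u3).
        -- intros x Hx.
           destruct (Cu (fun _ => 0) (fun _ _ => continuous_const _ _) x Hx) as (C0 & C1 & C2).
           apply (continuous_mult (fun _ => - (2 / sigma))); [apply continuous_const|].
           apply (continuous_plus (fun t => u2 0 t)); [exact C2|].
           apply (continuous_mult (fun t => 2 * u 0 t)); [|exact C1].
           apply (continuous_mult (fun _ => 2)); [apply continuous_const|exact C0].
        -- intros x Hx; unfold I0_integrand, theta, thetay.
           rewrite HY0, HZY, Hexp by (auto; now apply Hends).
           destruct (Hflux 0 x Hx) as [F1 F2].
           rewrite (Rmult_plus_distr_l (hE sigma m u 0 x)), F2, F1.
           field; lra.
        -- exact (filterlim_comp _ _ _ _ (fun y => - (2 / sigma) * y) _ _ _ Hu0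
             (continuous_mult (fun _ => - (2 / sigma)) (fun y => y) 0
               (continuous_const _ _) (continuous_id _))).
      * specialize (HE 0 t Ht); unfold hE in HE.
        replace (1 + m * (- (2 / sigma) * u 0 t - - (2 / sigma) * 0))
          with (1 - 2 * m / sigma * u 0 t) by (field; lra); lra.
      * rewrite HY0 by exact Ht; unfold hY, hE.
        replace (1 + m * (- (2 / sigma) * u 0 t - - (2 / sigma) * 0))
          with (1 - 2 * m / sigma * u 0 t) by (field; lra).
        field; lra.
Qed.
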